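(* Consider the regression model $Y=f^*(X)+\zeta$, where $\zeta$ is a mean-zero noise that is independent of $X$. Assume that $\zeta\in L_2$, put $\sigma^2=\mathbb{E}\zeta^2$, and assume that $f^*\in\operatorname{span}(F)$, where $F=\{f_1,\ldots,f_M\}$. If there are constants $\kappa_0>0$ and $\beta_0>0$ for which $$P\bigl(|f(X)|\ge \kappa_0\|f\|_{L_2}\bigr)\ge \beta_0\qquad\text{for every } f\in\operatorname{span}(F),$$ and $N\ge(400)^2M/\beta_0^2$, then for every $x>0$, with probability at least $1-\exp(-\beta_0^2N/4)-1/x$, $$\|\hat f-f^*\|_{L_2}^2\le\left(\frac{16}{\beta_0\kappa_0^2}\right)^2\frac{\sigma^2Mx}{N},$$ where $\hat f\in\operatorname{arg\,min}_{f\in\operatorname{span}(F)}R_N(f)$ is the empirical risk minimizer.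
   Context: $(\mathcal{X},\mu)$ is a probability space, $X$ is a random variable with values in $\mathcal{X}$ distributed according to $\mu$. $(X_i,Y_i)_{i=1}^N$ are $N$ independent copies of $(X,Y)$; ''with probability'' refers to this sample. $F=\{f_1,\ldots,f_M\}$ is a finite set (dictionary) of real-valued measurable functions on $\mathcal{X}$ with $\mathbb{E}f_j(X)^2<\infty$, and $\operatorname{span}(F)=\{\sum_{j=1}^M t_jf_j : t\in\mathbb{R}^M\}$. $\|f\|_{L_2}=(\mathbb{E}f(X)^2)^{1/2}$; for a sample-dependent $\hat f$, $\|\hat f-f^*\|_{L_2}^2=\mathbb{E}\bigl((\hat f(X)-f^*(X))^2\mid (X_i,Y_i)_{i=1}^N\bigr)$ with $X$ independent of the sample. The empirical risk is $R_N(f)=\frac1N\sum_{i=1}^N(Y_i-f(X_i))^2$. *)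

(* Defs.v *)
From HB Require Import structures.
From mathcomp Require Import all_boot all_order all_algebra.
From mathcomp Require Import all_classical all_reals all_analysis.

Set Implicit Arguments.
Unset Strict Implicit.
Unset Printing Implicit Defensive.

Import Order.TTheory GRing.Theory Num.Theory.
Import numFieldNormedType.Exports.

Local Open Scope classical_set_scope.
Local Open Scope ring_scope.

Definition dict_span (R : realType) (T : Type) (M : nat)
    (F : 'I_M -> T -> R) : set (T -> R) :=
  [set f | exists t : 'I_M -> R, f = fun x => \sum_(j < M) t j * F j x].

(* (E f(X)^2)^(1/2), with value +oo when f(X) is not square integrable. *)
Definition L2norm (R : realType) d d' (T : measurableType d)
    (U : measurableType d') (P : probability T R) (X : {RV P >-> U})
    (f : U -> R) : \bar R :=
  'N[P]_(2%:E) [EFin \o (f \o X)]%E.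

Definition independent_RVs (R : realType) d d1 d2 (T : measurableType d)
    (U1 : measurableType d1) (U2 : measurableType d2) (P : probability T R)
    (X1 : {RV P >-> U1}) (X2 : {RV P >-> U2}) : Prop :=
  forall (A : set U1) (B : set U2), measurable A -> measurable B ->
    P (X1 @^-1` A `&` X2 @^-1` B) = (P (X1 @^-1` A) * P (X2 @^-1` B))%E.

Definition mutually_independent (R : realType) d d' (T : measurableType d)
    (U : measurableType d') (P : probability T R) (N : nat)
    (Z : 'I_N -> {RV P >-> U}) : Prop :=
  forall (J : {set 'I_N}) (A : 'I_N -> set U), (forall i, measurable (A i)) ->
    P (\bigcap_(i in [set i | i \in J]) (Z i @^-1` A i)) =
    (\prod_(i in J) P (Z i @^-1` A i))%E.

(* The Z i live on their own probability space (S, Q), which need not be the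
   space (T, P) of the variable they are copies of. *)
Definition independent_copies (R : realType) dT dS d1 d2
    (T : measurableType dT) (S : measurableType dS)
    (U1 : measurableType d1) (U2 : measurableType d2)
    (P : probability T R) (Q : probability S R)
    (X : {RV P >-> U1}) (Y : {RV P >-> U2})
    (N : nat) (Z : 'I_N -> {RV Q >-> (U1 * U2)%type}) : Prop :=
  mutually_independent Z /\
  forall i (C : set (U1 * U2)), measurable C ->
    Q (Z i @^-1` C) = P ((fun w => (X w, Y w)) @^-1` C).

Definition empirical_risk (R : realType) (U : Type) (N : nat)
    (z : 'I_N -> U * R) (f : U -> R) : R :=
  N%:R^-1 * \sum_(i < N) ((z i).2 - f (z i).1) ^+ 2.

Definition argmin (R : realType) (V : Type) (A : set V) (r : V -> R) : set V :=
  [set v | A v /\ forall v', A v' -> r v <= r v'].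

(* E need not be measurable (in the application it depends on an arbitrary
   selection of minimizers), so the bound is on the inner probability of E. *)
Definition with_probability_at_least (R : realType) d (T : measurableType d)
    (P : probability T R) (p : R) (E : set T) : Prop :=
  exists A : set T, [/\ measurable A, A `<=` E & (p%:E <= P A)%E].

(* Main.v *)
Require Import Defs.
From HB Require Import structures.
From mathcomp Require Import all_boot all_order all_algebra.
From mathcomp Require Import all_classical all_reals all_analysis.
From mathcomp Require Import measurable_realfun ring lra.

Set Implicit Arguments.
Unset Strict Implicit.
Unset Printing Implicit Defensive.

Import Order.TTheory GRing.Theory Num.Theory.
Import numFieldNormedType.Exports.

Local Open Scope classical_set_scope.
Local Open Scope ring_scope.

(** Write h for the error of the empirical risk minimizer, an element of the
    span, and ||h|| for its L2 norm.  The minimizer does at least as well on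
    the sample as the target, and expanding the squares turns this into
      sum_i h(X_i)^2 <= 2 sum_i zeta_i h(X_i)          ([erm_basic_inequality]).
    The left side is quadratic in h and the right side linear, so a lower bound
    of the former and an upper bound of the latter, both uniform over the span,
    bound ||h||.

    Lower bound ([small_ball_sample]).  Outside an event of probability at most
    exp(- beta^2 N / 4), every f in the span satisfies |f(X_i)| >= kappa ||f||
    for at least beta N / 8 indices i, so that the left side is at least
    D ||h||^2 with D = kappa^2 beta N / 8.  Since the sample size must not depend
    on kappa, Lipschitz approximations of the indicators of |f| >= kappa ||f||
    are of no use, and the argument is combinatorial.  These sets are
    unions of two affine half-spaces in the M coordinates f_1, ..., f_M, so they
    leave few traces on a finite set of points: [sign_pattern_count] counts the
    cells of a hyperplane arrangement by deletion and restriction.  Introducing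
    a ghost sample and exchanging at random each X_i with its ghost reduces the
    uniform statement to a union bound over the traces on 2 N points
    ([count_lower_tail_ghost]), and N >= 400^2 M / beta^2 makes the number of
    traces negligible against the exponential gain.  Measurability is obtained
    by restricting to rational coefficients: a function that fails the bound
    does so by strict inequalities, which persist under small perturbations.

    Upper bound ([noise_energy_tail]).  The linear functional
    L(f) = sum_i zeta_i f(X_i) satisfies E L(f)^2 = N sigma^2 ||f||^2 because the
    summands are uncorrelated.  For an orthonormal family e_1, ..., e_k of the
    span, k <= M, Markov's inequality therefore gives
    sum_l L(e_l)^2 <= x N M sigma^2 with probability at least 1 - 1/x.  The f_j
    may be linearly dependent in L2; the Gram-Schmidt residuals then have norm
    zero and L vanishes on them almost surely, so that
    L(h) = sum_l <h, e_l> L(e_l) holds on the sample in all cases.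

    On the intersection of these events,
    D ||h||^2 <= 2 sum_l <h, e_l> L(e_l), and completing squares
    ([quadratic_absorption]) gives ||h||^2 <= (4 / D^2) sum_l L(e_l)^2
    <= (4 / D^2) x N M sigma^2, which is the announced bound. *)

(** * Counting sign patterns *)

(** Deletion step of the pattern count: dropping the first sign merges exactly
    the pairs that differ in it only. *)
Lemma size_le_behead_split (L : seq (seq bool)) : uniq L ->
  (forall p, p \in L -> p != [::]) ->
  (size L <= size (undup (map behead L)) +
     size [seq p <- undup (map behead L) | (true :: p \in L) && (false :: p \in L)])%N.
Proof.
move=> uL nL; set L' := undup _.
pose L1 := [seq p <- L' | true :: p \in L].
pose L0 := [seq p <- L' | false :: p \in L].
have uL' : uniq L' by exact: undup_uniq.
have inL : {subset L <= map (cons true) L1 ++ map (cons false) L0}.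
  move=> [|b p] pL; first by have := nL _ pL.
  have pL' : p \in L' by rewrite mem_undup; apply/mapP; exists (b :: p).
  rewrite mem_cat; case: b pL => pL.
    by apply/orP; left; apply: map_f; rewrite mem_filter pL.
  by apply/orP; right; apply: map_f; rewrite mem_filter pL.
have := uniq_leq_size uL inL.
rewrite size_cat !size_map !size_filter => /leq_trans; apply.
rewrite -count_predUI leq_add ?count_size//.
Qed.

(** Deletion and restriction, by induction on the number of points.  A pattern of
    the last points that extends with both signs at v is realized, through a
    nonnegative combination, at a parameter on the hyperplane orthogonal to v, which has one
    dimension less.  The recursion g(n+1, r) <= g(n, r) + g(n, r-1) is the one of
    the sums of binomial coefficients; the weight y^-r (1 + y)^n satisfies it with
    equality, and a free y is more convenient than the optimized bound. *)
Lemma sign_pattern_count (R : realFieldType) (y : R) (y0 : 0 < y) (y1 : y <= 1)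
    (r : nat) (pts : seq 'cV[R]_r) (L : seq (seq bool)) : uniq L ->
  (forall p, p \in L ->
     exists t : 'rV[R]_r, p = [seq 0 <= (t *m v) 0 0 | v <- pts]) ->
  (size L)%:R <= y^-1 ^+ r * (1 + y) ^+ size pts.
Proof.
have yV1 : 1 <= y^-1 by rewrite invf_ge1.
move En : (size pts) => n; elim: n => [|n IH] in r pts En L *.
  move=> uL Lr.
  move: pts En Lr => [|//] _ Lr.
  rewrite expr0 mulr1 (@le_trans _ _ 1)//; last exact: exprn_ege1.
  rewrite -[1]/(1%:R) ler_nat -[1%N]/(size [:: [::] : seq bool]).
  rewrite uniq_leq_size// => p /Lr[t ->].
  by rewrite inE.
move: pts En => [//|v pts] [En] uL Lr.
pose L' := undup (map behead L).
pose L'' := [seq p <- L' | (true :: p \in L) && (false :: p \in L)].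
have le2 : (size L <= size L' + size L'')%N.
  by apply: size_le_behead_split => // p /Lr[t ->].
have bL' : (size L')%:R <= y^-1 ^+ r * (1 + y) ^+ n.
  apply: (IH _ pts) => //; first exact: undup_uniq.
  by move=> p; rewrite mem_undup => /mapP[_ /Lr[t ->] ->]; exists t.
have bL'' : (size L'')%:R <= y * (y^-1 ^+ r * (1 + y) ^+ n).
  (* If v = 0 the sign at v is constant, so no pattern extends in two ways. *)
  have [v0|v0] := eqVneq v 0.
    suff -> : L'' = [::].
      by rewrite !mulr_ge0 ?exprn_ge0// ?ltW// ?invr_gt0// addr_gt0.
    apply/eqP; rewrite -size_eq0 size_filter -leqn0 leqNgt -has_count.
    apply/hasPn => p _; apply/negP => /andP[_ /Lr[t]].
    by rewrite v0 /= mulmx0 mxE lexx.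
  pose K := row_base (kermx v).
  have rv : \rank v = 1%N.
    by apply/eqP; rewrite eqn_leq rank_leq_col lt0n mxrank_eq0.
  have rK : (\rank (kermx v)).+1 = r.
    by rewrite mxrank_ker rv subn1 prednK// -rv rank_leq_row.
  have -> : y * (y^-1 ^+ r * (1 + y) ^+ n) =
      y^-1 ^+ (\rank (kermx v)) * (1 + y) ^+ n.
    by rewrite -{1}rK mulrA exprS mulrA divff ?mul1r// gt_eqF.
  apply: (IH _ [seq K *m u | u <- pts]).
  - by rewrite size_map.
  - by rewrite filter_uniq// undup_uniq.
  move=> p; rewrite mem_filter => /andP[/andP[]].
  move=> /Lr[t1 /= [/esym t1v p1]] /Lr[t2 /= [/esym t2v p2]] _.
  move: t2v => /negbT; rewrite -ltNge => t2v.
  pose a := (t1 *m v) 0 0; pose b := - (t2 *m v) 0 0.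
  have a0 : 0 <= a by [].
  have b0 : 0 < b by rewrite oppr_gt0.
  (* Both weights are nonnegative, which preserves every sign on which t1 and t2
     agree, and they cancel the values at v. *)
  pose t := b *: t1 + a *: t2.
  have tE (u : 'cV_r) : (t *m u) 0 0 = b * (t1 *m u) 0 0 + a * (t2 *m u) 0 0.
    by rewrite mulmxDl -!scalemxAl !mxE.
  have tv : t *m v = 0.
    apply/matrixP => i j; rewrite !ord1 tE [in RHS]mxE /a /b; ring.
  have /submxP[w tw] : (t <= K)%MS.
    by rewrite eq_row_base; apply/sub_kermxP.
  exists w; rewrite -map_comp p1; apply/eq_in_map => u upts /=.
  have e12 : (0 <= (t1 *m u) 0 0) = (0 <= (t2 *m u) 0 0).
    move: p2; rewrite p1 => p2; exact: (iffRL (eq_in_map _ _ _) p2 u upts).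
  rewrite mulmxA -tw tE.
  move: e12; case: (leP 0 ((t1 *m u) 0 0)) => h1; case: (leP 0 ((t2 *m u) 0 0)) => h2 // _.
    by rewrite addr_ge0// mulr_ge0// ltW.
  apply/esym/negbTE; rewrite -ltNge.
  by rewrite -[ltRHS]addr0 ltr_leD// ?pmulr_rlt0// mulr_ge0_le0// ltW.
have := le2; rewrite -(ler_nat R) natrD => /le_trans; apply.
apply: (le_trans (lerD bL' bL'')).
by rewrite /= exprS [leRHS]mulrCA [leRHS]mulrDl mul1r.
Qed.

(** Finite choice of preimages, in the form that transfers a bound on the number
    of codes to a bound on the number of decoded objects. *)
Lemma seq_preimage (T1 T2 : eqType) (f : T1 -> T2) (Pr : T1 -> Prop) (L : seq T2) :
  (forall p, p \in L -> exists2 q, Pr q & f q = p) ->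
  exists2 L', map f L' = L & forall q, q \in L' -> Pr q.
Proof.
elim: L => [|p L IH] h; first by exists [::].
have [q Pq fq] := h p (mem_head _ _).
have [p' p'L|L' <- PL'] := IH; first by apply: h; rewrite inE p'L orbT.
exists (q :: L'); first by rewrite /= fq.
by move=> q'; rewrite inE => /predU1P[->//|/PL'].
Qed.

(** The event c <= |<t, x>| is the disjunction of two affine conditions, on x and
    on -x.  Adding the threshold as a coordinate makes them linear, whence the
    dimension r + 1 and the doubled number of points. *)
Lemma slab_pattern_count (R : realFieldType) (y : R) (y0 : 0 < y) (y1 : y <= 1)
    (r : nat) (J : finType) (x : J -> 'cV[R]_r) (L : seq {ffun J -> bool}) : uniq L ->
  (forall p, p \in L ->
     exists (t : 'rV[R]_r) (c : R), p = [ffun j => c <= `|(t *m x j) 0 0|]) ->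
  (size L)%:R <= y^-1 ^+ r.+1 * (1 + y) ^+ (2 * #|J|).
Proof.
move=> uL hL.
have [en [szen inen]] : exists en : seq J, size en = #|J| /\ forall j, j \in en.
  by exists (enum J); rewrite cardE; split=> // j; rewrite mem_enum.
pose lift_pt (sg : bool) (j : J) : 'cV[R]_(r + 1) :=
  col_mx (if sg then x j else - x j) (- 1%:M).
pose pts := [seq lift_pt true j | j <- en] ++ [seq lift_pt false j | j <- en].
(* A point lies outside the open slab when one of its two signs is nonnegative. *)
pose dec (q : seq bool) : {ffun J -> bool} := [ffun j =>
  nth false q (index j en) || nth false q (#|J| + index j (en))].
pose Pr q := exists t : 'rV[R]_(r + 1), q = [seq 0 <= (t *m v) 0 0 | v <- pts].
have [p /hL[t [c ->]]|L' decL' PL'] := @seq_preimage _ _ dec Pr L.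
  pose t' : 'rV[R]_(r + 1) := row_mx t c%:M.
  exists [seq 0 <= (t' *m v) 0 0 | v <- pts]; first by exists t'.
  apply/ffunP => j; rewrite !ffunE.
  have ij : (index j en < #|J|)%N by rewrite -szen index_mem inen.
  have val sg : (t' *m lift_pt sg j) 0 0 = (if sg then 1 else -1) * (t *m x j) 0 0 - c.
    have cE : (- c%:M : 'M[R]_1) 0 0 = - c by rewrite !mxE eqxx mulr1n.
    rewrite mul_row_col mxE mulmxN mulmx1 cE.
    by case: sg; rewrite ?mul1r// mulmxN mxE mulN1r.
  rewrite /pts map_cat -!map_comp !nth_cat !size_map szen ij.
  rewrite ltnNge leq_addr /= addKn.
  rewrite !(nth_map j) ?szen// nth_index//= !val.
  by rewrite mul1r mulN1r !subr_ge0 ler_normr orbC orbC.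
have uL' : uniq L' by apply: (@map_uniq _ _ dec); rewrite decL'.
have := @sign_pattern_count _ y y0 y1 _ pts L' uL' PL'.
by rewrite -decL' size_map size_cat !size_map szen addnn -mul2n addn1.
Qed.

(** * Expectations: laws, independence, sums of uncorrelated variables *)

(** Bundles a measurable function so that its image measure is canonically a
    measure. *)
Definition mfun_of d d' (T : measurableType d) (U : measurableType d') (f : T -> U)
    (mf : measurable_fun setT f) : {mfun T >-> U} :=
  HB.pack f (isMeasurableFun.Build _ _ _ _ f mf).

Section same_law.
Context (R : realType) d d1 d2 (T : measurableType d) (S : measurableType d1)
  (V : measurableType d2) (P : probability T R) (Q : probability S R).
Variables (f : T -> V) (g : S -> V).
Hypotheses (mf : measurable_fun setT f) (mg : measurable_fun setT g).
Hypothesis fg : forall A, measurable A -> P (f @^-1` A) = Q (g @^-1` A).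

Lemma ge0_integral_same_law (phi : V -> \bar R) : measurable_fun [set: V] phi ->
  (forall v, 0 <= phi v)%E ->
  (\int[P]_w phi (f w) = \int[Q]_w phi (g w))%E.
Proof.
move=> mphi phi0.
have := @ge0_integral_pushforward _ _ _ _ R _ mf P setT phi measurableT mphi
  (fun y _ => phi0 y).
rewrite preimage_setT /= => <-.
have := @ge0_integral_pushforward _ _ _ _ R _ mg Q setT phi measurableT mphi
  (fun y _ => phi0 y).
rewrite preimage_setT /= => <-.
apply: (@eq_measure_integral _ _ _ _ (pushforward Q (mfun_of mg))
  (pushforward P (mfun_of mf))).
by move=> A mA _; exact: fg.
Qed.

Lemma integrable_same_law (phi : V -> R) : measurable_fun setT phi ->
  Q.-integrable setT (EFin \o (phi \o g)) -> P.-integrable setT (EFin \o (phi \o f)).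
Proof.
move=> mphi /integrableP[_ fin]; apply/integrableP; split.
  by apply/measurable_EFinP; exact: measurableT_comp.
apply: le_lt_trans fin.
by rewrite (@ge0_integral_same_law (fun v => `|(phi v)%:E|)%E)//=;
  do 2 apply: measurableT_comp => //.
Qed.

Lemma integral_same_law (phi : V -> R) : measurable_fun setT phi ->
  Q.-integrable setT (EFin \o (phi \o g)) ->
  \int[P]_w phi (f w) = \int[Q]_w phi (g w).
Proof.
move=> mphi iphi; congr fine.
have mphi' : measurable_fun setT (EFin \o phi) by exact/measurable_EFinP.
have := @integral_pushforward _ _ _ _ R _ mf P setT _ mphi'.
rewrite preimage_setT /= => <-//; last exact: integrable_same_law.
have := @integral_pushforward _ _ _ _ R _ mg Q setT _ mphi'.
rewrite preimage_setT /= => <-//.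
apply: (@eq_measure_integral _ _ _ _ (pushforward Q (mfun_of mg))
  (pushforward P (mfun_of mf))).
by move=> A mA _; exact: fg.
Qed.

End same_law.

Section product_expectation.
Context (R : realType) d d1 d2 (T : measurableType d) (U1 : measurableType d1)
  (U2 : measurableType d2) (P : probability T R).
Variables (f : T -> U1) (g : T -> U2).
Hypotheses (mf : measurable_fun setT f) (mg : measurable_fun setT g).
Hypothesis fg : forall A B, measurable A -> measurable B ->
  P (f @^-1` A `&` g @^-1` B) = (P (f @^-1` A) * P (g @^-1` B))%E.

Let p1 := distribution P (mfun_of mf).
Let p2 := distribution P (mfun_of mg).
Let p12 := distribution P (mfun_of (measurable_fun_pair mf mg)).

Let p12E A : measurable A -> (p1 \x p2)%E A = p12 A.
Proof.
by apply: product_measure_unique => A' B mA mB; exact: fg.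
Qed.

Lemma ge0_integral_indep (phi : U1 -> R) (psi : U2 -> R) :
  measurable_fun setT phi -> measurable_fun setT psi ->
  (forall u, 0 <= phi u) -> (forall u, 0 <= psi u) ->
  (\int[P]_w (phi (f w) * psi (g w))%:E =
   (\int[P]_w (phi (f w))%:E) * \int[P]_w (psi (g w))%:E)%E.
Proof.
move=> mphi mpsi phi0 psi0.
have mphi' : measurable_fun setT (EFin \o phi) by exact/measurable_EFinP.
have mpsi' : measurable_fun setT (EFin \o psi) by exact/measurable_EFinP.
pose h (z : U1 * U2) := (phi z.1 * psi z.2)%:E.
have mh : measurable_fun setT h.
  apply/measurable_EFinP; apply: measurable_funM.
    exact: (measurableT_comp mphi).
  exact: (measurableT_comp mpsi).
have h0 z : (0 <= h z)%E by rewrite lee_fin mulr_ge0.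
transitivity (\int[p12]_z h z)%E.
  by rewrite ge0_integral_distribution.
transitivity (\int[p1 \x p2]_z h z)%E.
  by apply/esym/eq_measure_integral => A mA _; exact: p12E.
rewrite fubini_tonelli1// /fubini_F.
under eq_integral => x _.
  rewrite /h /=; under eq_integral => y _ do rewrite EFinM.
  rewrite ge0_integralZl//; last 2 first.
    by move=> y _; rewrite lee_fin.
    by rewrite lee_fin.
  over.
rewrite ge0_integralZr//; last 2 first.
  by move=> y _; rewrite lee_fin.
  by apply: integral_ge0 => y _; rewrite lee_fin.
congr (_ * _)%E.
  by apply: (ge0_integral_distribution (mfun_of mf) mphi') => y; rewrite lee_fin.
by apply: (ge0_integral_distribution (mfun_of mg) mpsi') => y; rewrite lee_fin.
Qed.

Lemma integrable_indep (phi : U1 -> R) (psi : U2 -> R) :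
  measurable_fun setT phi -> measurable_fun setT psi ->
  P.-integrable setT (EFin \o (phi \o f)) -> P.-integrable setT (EFin \o (psi \o g)) ->
  P.-integrable setT (EFin \o (fun w => phi (f w) * psi (g w))).
Proof.
move=> mphi mpsi /integrableP[_ i1] /integrableP[_ i2]; apply/integrableP; split.
  by apply/measurable_EFinP; apply: measurable_funM; exact: measurableT_comp.
under eq_integral => w _ do rewrite /= normrM.
rewrite (@ge0_integral_indep (fun u => `|phi u|) (fun u => `|psi u|))//=.
- rewrite lte_mul_pinfty//.
    by apply: integral_ge0.
  by rewrite ge0_fin_numE//; apply: integral_ge0.
- exact: measurableT_comp.
- exact: measurableT_comp.
Qed.

Lemma integral_indep (phi : U1 -> R) (psi : U2 -> R) :
  measurable_fun setT phi -> measurable_fun setT psi ->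
  P.-integrable setT (EFin \o (phi \o f)) -> P.-integrable setT (EFin \o (psi \o g)) ->
  \int[P]_w (phi (f w) * psi (g w)) =
  (\int[P]_w phi (f w)) * \int[P]_w psi (g w).
Proof.
move=> mphi mpsi i1 i2.
have mphi' : measurable_fun setT (EFin \o phi) by exact/measurable_EFinP.
have mpsi' : measurable_fun setT (EFin \o psi) by exact/measurable_EFinP.
pose h (z : U1 * U2) := (phi z.1 * psi z.2)%:E.
have mh : measurable_fun setT h.
  apply/measurable_EFinP; apply: measurable_funM.
    exact: (measurableT_comp mphi).
  exact: (measurableT_comp mpsi).
have ih : p12.-integrable setT h.
  by apply: integrable_pushforward => //; rewrite preimage_setT; exact: integrable_indep.
have ih' : (p1 \x p2)%E.-integrable setT h.
  apply/integrableP; split => //; move/integrableP : ih => [_].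
  apply: le_lt_trans; rewrite le_eqVlt; apply/orP; left; apply/eqP.
  by apply: eq_measure_integral => A mA _; exact: p12E.
have fi2 : (\int[p2]_y (psi y)%:E)%E \is a fin_num.
  rewrite integral_distribution//; exact: integrable_fin_num.
have fi1 : (\int[p1]_y (phi y)%:E)%E \is a fin_num.
  rewrite integral_distribution//; exact: integrable_fin_num.
rewrite /Rintegral -fineM; last 2 first.
- exact: integrable_fin_num.
- exact: integrable_fin_num.
congr fine.
transitivity (\int[p12]_z h z)%E.
  by rewrite integral_distribution//; exact: integrable_indep.
transitivity (\int[p1 \x p2]_z h z)%E.
  by apply/esym/eq_measure_integral => A mA _; exact: p12E.
transitivity (\int[p1]_x \int[p2]_y (phi x * psi y)%:E)%E.
  by rewrite -integral12_prod_meas1.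
have j1 : p1.-integrable setT (EFin \o phi).
  by apply: integrable_pushforward => //; rewrite preimage_setT.
have j2 : p2.-integrable setT (EFin \o psi).
  by apply: integrable_pushforward => //; rewrite preimage_setT.
transitivity (\int[p1]_x ((phi x)%:E * (fine (\int[p2]_y (psi y)%:E))%:E))%E.
  apply: eq_integral => x _; under eq_integral => y _ do rewrite EFinM.
  by rewrite integralZl// fineK.
rewrite integralZr// fineK//; congr (_ * _)%E.
  exact: (@integral_distribution _ _ _ _ _ P (mfun_of mf) (EFin \o phi) mphi' i1).
exact: (@integral_distribution _ _ _ _ _ P (mfun_of mg) (EFin \o psi) mpsi' i2).
Qed.

End product_expectation.

Lemma measurable_set_lt (R : realType) d (T : measurableType d) (f g : T -> R) :
  measurable_fun setT f -> measurable_fun setT g -> measurable [set w | f w < g w].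
Proof.
move=> mf mg; have := measurable_fun_ltr mf mg measurableT (Y := [set true]).
by rewrite setTI; apply.
Qed.

Lemma measurable_set_le (R : realType) d (T : measurableType d) (f g : T -> R) :
  measurable_fun setT f -> measurable_fun setT g -> measurable [set w | f w <= g w].
Proof. by move=> mf mg; rewrite -[X in measurable X]setTI; exact: measurable_fun_le. Qed.

(** Converse of [Lfun2_integrable_sqr]. *)
Lemma Lfun2_of_sqr (R : realType) d (T : measurableType d) (P : probability T R)
    (f : T -> R) : measurable_fun setT f ->
  P.-integrable setT (EFin \o (fun w => f w ^+ 2)) -> f \in Lfun P 2%:E.
Proof.
move=> mf /integrableP[_ fin].
rewrite inE; apply/andP; split; rewrite inE//= /finite_norm unlock /Lnorm.
rewrite poweR_lty//; apply: le_lt_trans fin.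
rewrite le_eqVlt; apply/orP; left; apply/eqP; apply: eq_integral => w _ /=.
by rewrite normrX -powR_mulrn.
Qed.

Lemma Lfun2_measurable (R : realType) d (T : measurableType d) (P : probability T R)
    (f : T -> R) : f \in Lfun P 2%:E -> measurable_fun setT f.
Proof. by rewrite inE => /andP[+ _]; rewrite inE. Qed.

Lemma Lfun2_integrableM (R : realType) d (T : measurableType d) (P : probability T R)
    (f g : T -> R) : f \in Lfun P 2%:E -> g \in Lfun P 2%:E ->
  P.-integrable setT (EFin \o (fun w => f w * g w)).
Proof. by move=> f2 g2; apply/Lfun1_integrable; exact: Lfun2_mul_Lfun1. Qed.

Lemma Lfun2_integrable (R : realType) d (T : measurableType d) (P : probability T R)
    (f : T -> R) : f \in Lfun P 2%:E -> P.-integrable setT (EFin \o f).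
Proof.
move=> f2; apply/Lfun1_integrable; apply: (@Lfun_subset12 _ _ _ P) => //.
exact: fin_num_measure.
Qed.

Lemma Lfun2_sum (R : realType) d (T : measurableType d) (P : probability T R)
    (I : Type) (r : seq I) (f : I -> T -> R) : (forall i, f i \in Lfun P 2%:E) ->
  (fun w => \sum_(i <- r) f i w) \in Lfun P 2%:E.
Proof.
move=> f2; rewrite -fct_sumE.
elim: r => [|i r IH]; first by rewrite big_nil; exact: (Lfun_cst P 0).
have c := Lfun_addr_closed P (lee1n 2) : addr_closed (Lfun P 2%:E).
by rewrite big_cons; apply: c.2.
Qed.

Lemma Rintegral_prob_cst (R : realType) d (T : measurableType d) (P : probability T R)
    (c : R) : \int[P]_w (cst c w) = c.
Proof.
transitivity (c * fine (P setT)); first exact: Rintegral_cst.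
by rewrite probability_setT mulr1.
Qed.

Lemma integrable_sumR (R : realType) d (T : measurableType d) (P : probability T R)
    (I : Type) (r : seq I) (f : I -> T -> R) :
  (forall i, P.-integrable setT (EFin \o f i)) ->
  P.-integrable setT (EFin \o (fun w => \sum_(i <- r) f i w)).
Proof.
move=> fi; rewrite (_ : EFin \o _ = fun w => (\sum_(i <- r) (f i w)%:E)%E).
  by apply: integrable_sum => // i _; exact: fi.
by apply/funext => w /=; rewrite sumEFin.
Qed.

Lemma Rintegral_sum (R : realType) d (T : measurableType d) (P : probability T R)
    (I : Type) (r : seq I) (f : I -> T -> R) :
  (forall i, P.-integrable setT (EFin \o f i)) ->
  \int[P]_w (\sum_(i <- r) f i w) = \sum_(i <- r) \int[P]_w f i w.
Proof.
move=> fi; elim: r => [|i r IH].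
  by under eq_Rintegral do rewrite big_nil; rewrite big_nil Rintegral_cst// mul0r.
under eq_Rintegral do rewrite big_cons.
by rewrite big_cons RintegralD// ?IH//; exact: integrable_sumR.
Qed.

Lemma markov_Rintegral (R : realType) d (T : measurableType d) (P : probability T R)
    (f : T -> R) (c : R) : measurable_fun setT f -> P.-integrable setT (EFin \o f) ->
  (forall w, 0 <= f w) -> 0 < c ->
  (P [set w | (c <= f w)%R] <= ((\int[P]_w f w) / c)%:E)%E.
Proof.
move=> mf fi f0 c0.
have := @markov _ _ _ P (mfun_of mf) idfun c c0 (@measurable_id _ _ setT)
  (fun r h => h) (fun x y _ _ h => h).
rewrite mulrC EFinM lee_pdivlMl//.
rewrite (_ : [set x | _] = [set w | (c <= f w)%R]); last first.
  by apply/seteqP; split => w /=; rewrite lee_fin ger0_norm.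
move=> /le_trans; apply.
rewrite unlock fineK; last exact: integrable_fin_num.
rewrite le_eqVlt; apply/orP; left; apply/eqP; apply: eq_integral => w _ /=.
by rewrite ger0_norm.
Qed.

(** Pythagoras: only the diagonal of the double sum survives. *)
Lemma Rintegral_sqr_sum (R : realType) d (T : measurableType d) (P : probability T R)
    (N : nat) (W : 'I_N -> T -> R) (v : R) : (forall i, W i \in Lfun P 2%:E) ->
  (forall i, \int[P]_w (W i w ^+ 2) = v) ->
  (forall i j, i != j -> \int[P]_w (W i w * W j w) = 0) ->
  \int[P]_w ((\sum_(i < N) W i w) ^+ 2) = N%:R * v.
Proof.
move=> W2 Wv W0.
under eq_Rintegral.
  move=> w _; rewrite expr2 mulr_suml.
  under eq_bigr do rewrite mulr_sumr.
  over.
rewrite Rintegral_sum => [|i]; last first.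
  by apply: integrable_sumR => j; exact: Lfun2_integrableM.
rewrite (eq_bigr (fun=> v)) => [|i _].
  by rewrite sumr_const card_ord mulr_natl.
rewrite Rintegral_sum => [|j]; last exact: Lfun2_integrableM.
rewrite (bigD1 i)//= big1 ?addr0 => [|j ji]; last by rewrite W0// eq_sym.
by rewrite -(Wv i); apply: eq_Rintegral => w _; rewrite expr2.
Qed.

Section iid.
Context (R : realType) d d1 d2 (T : measurableType d) (S : measurableType d1)
  (V : measurableType d2) (P : probability T R) (Q : probability S R).
Variables (N : nat) (Z : 'I_N -> S -> V) (g : T -> V).
Hypotheses (mZ : forall i, measurable_fun setT (Z i)) (mg : measurable_fun setT g).
Hypothesis lawZ : forall i A, measurable A -> Q (Z i @^-1` A) = P (g @^-1` A).
Hypothesis indZ : forall i j, i != j -> forall A B, measurable A -> measurable B ->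
  Q (Z i @^-1` A `&` Z j @^-1` B) = (Q (Z i @^-1` A) * Q (Z j @^-1` B))%E.

Lemma iid_Lfun2 (phi : V -> R) : measurable_fun setT phi ->
  phi \o g \in Lfun P 2%:E -> forall i, phi \o Z i \in Lfun Q 2%:E.
Proof.
move=> mphi phi2 i; apply: Lfun2_of_sqr; first exact: measurableT_comp.
apply: (integrable_same_law (mZ i) mg (lawZ i) (phi := fun v => phi v ^+ 2)).
  exact: measurable_funX.
exact: Lfun2_integrable_sqr.
Qed.

Lemma iid_mean_square (phi : V -> R) : measurable_fun setT phi ->
  phi \o g \in Lfun P 2%:E -> \int[P]_w phi (g w) = 0 ->
  \int[Q]_s ((\sum_(i < N) phi (Z i s)) ^+ 2) = N%:R * \int[P]_w (phi (g w) ^+ 2).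
Proof.
move=> mphi phi2 phi0; apply: Rintegral_sqr_sum => [i|i|i j ij].
- exact: iid_Lfun2.
- apply: (integral_same_law (mZ i) mg (lawZ i) (phi := fun v => phi v ^+ 2)).
    exact: measurable_funX.
  exact: Lfun2_integrable_sqr.
- rewrite (integral_indep (mZ i) (mZ j) (indZ ij) mphi mphi).
  + rewrite (integral_same_law (mZ i) mg (lawZ i) mphi) ?phi0 ?mul0r//.
    exact: Lfun2_integrable.
  + exact/Lfun2_integrable/iid_Lfun2.
  + exact/Lfun2_integrable/iid_Lfun2.
Qed.

(** Chebyshev's inequality, with the variance p (1 - p) of an indicator bounded by
    p. *)
Lemma iid_count_lower_tail (A : set V) (p b : R) : measurable A ->
  P (g @^-1` A) = p%:E -> b < N%:R * p ->
  (Q [set s | (\sum_(i < N) \1_A (Z i s) < b)%R] <=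
    (N%:R * p / (N%:R * p - b) ^+ 2)%:E)%E.
Proof.
move=> mA Ap bp.
have mA' : measurable (g @^-1` A) by rewrite -[X in measurable X]setTI; exact: mg.
have p0 : 0 <= p by rewrite -lee_fin -Ap.
pose phi (v : V) : R := \1_A v - p.
have mphi : measurable_fun setT phi by apply: measurable_funB.
have i1 : P.-integrable setT (EFin \o (\1_(g @^-1` A) : T -> R)).
  by apply: integrable_indic => //; rewrite Ap ltry.
have ip : P.-integrable setT (EFin \o (cst p : T -> R)).
  by apply: finite_measure_integrable_cst.
have Ei : \int[P]_w (\1_(g @^-1` A) w) = p.
  rewrite /Rintegral (_ : (\int[P]_w (\1_(g @^-1` A) w)%:E)%E = P (g @^-1` A)) ?Ap//.
  by rewrite integral_indic// setIT.
(* The square of the centred indicator is affine in the indicator. *)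
have [q qE] : exists q, q = p ^+ 2 by exists (p ^+ 2).
have sqE w : phi (g w) ^+ 2 = (1 - 2 * p) * \1_(g @^-1` A) w + q.
  rewrite qE /phi !indicE; rewrite (_ : (g w \in A) = (w \in g @^-1` A)); last first.
    by apply/idP/idP; rewrite !inE.
  by case: (_ \in _) => /=; ring.
have isq : P.-integrable setT (EFin \o (fun w => (1 - 2 * p) * \1_(g @^-1` A) w)).
  by apply: (eq_integrable _ _ _ _ (integrableZl measurableT (1 - 2 * p) i1)).
have ip2 : P.-integrable setT (EFin \o (cst q : T -> R)).
  by apply: finite_measure_integrable_cst.
have phi2 : phi \o g \in Lfun P 2%:E.
  apply: Lfun2_of_sqr; first exact: measurableT_comp.
  apply: (eq_integrable _ _ _ _ (integrableD _ isq ip2)) => //.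
  by move=> w _ /=; rewrite sqE.
have phi0 : \int[P]_w phi (g w) = 0.
  rewrite (_ : (fun w => phi (g w)) = (fun w => \1_(g @^-1` A) w - (cst p w))); last by [].
  by rewrite RintegralB// Ei Rintegral_prob_cst subrr.
have phiv : \int[P]_w (phi (g w) ^+ 2) <= p.
  under eq_Rintegral do rewrite sqE.
  rewrite RintegralD// RintegralZl// Ei Rintegral_prob_cst.
  rewrite qE (_ : _ + _ = p - p ^+ 2); last by ring.
  by rewrite gerBl sqr_ge0.
have ms := iid_mean_square mphi phi2 phi0.
have sum2 : (fun s => \sum_(i < N) phi (Z i s)) \in Lfun Q 2%:E.
  by apply: Lfun2_sum => i; exact: iid_Lfun2.
have c0 : 0 < (N%:R * p - b) ^+ 2 by rewrite exprn_gt0// subr_gt0.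
have mkv := @markov_Rintegral _ _ _ Q (fun s => (\sum_(i < N) phi (Z i s)) ^+ 2) _
  (measurable_funX 2 (Lfun2_measurable sum2)) (Lfun2_integrable_sqr sum2)
  (fun _ => sqr_ge0 _) c0.
apply: le_trans (le_trans mkv _); last first.
  by rewrite ms lee_fin ler_pM2r ?invr_gt0// ler_wpM2l.
have mcount : measurable_fun setT (fun s => \sum_(i < N) (\1_A (Z i s) : R)).
  by apply: measurable_sum => i; apply: measurableT_comp.
apply: le_measure; rewrite ?inE.
- exact: measurable_set_lt.
- by apply: measurable_set_le => //; exact: (measurable_funX 2 (Lfun2_measurable sum2)).
move=> s /= sb; rewrite /phi sumrB sumr_const card_ord -mulr_natl.
nra.
Qed.

End iid.

Lemma Rintegral0_null (R : realType) d (S : measurableType d) (Q : probability S R)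
    (f : S -> R) : measurable_fun setT f -> Q.-integrable setT (EFin \o f) ->
  (forall s, 0 <= f s) -> \int[Q]_s f s = 0 -> Q [set s | 0 < f s] = 0%E.
Proof.
move=> mf fi f0 If.
have mpos : measurable [set s | 0 < f s] by apply: measurable_set_lt.
have I0 : (\int[Q]_s `|(f s)%:E| = 0)%E.
  under eq_integral do rewrite gee0_abs ?lee_fin//.
  rewrite -[LHS]fineK; last exact: integrable_fin_num.
  by move: If; rewrite /Rintegral => ->.
have [mfE _] := integrableP _ _ _ fi.
have := (ae_eq_integral_abs Q measurableT mfE).1 I0.
move=> [A [mA QA0 subA]].
apply/eqP; rewrite -measure_le0 -QA0; apply: le_measure; rewrite ?inE//.
move=> s /= fs; apply: subA => /= /(_ I) [fs0].
by rewrite fs0 ltxx in fs.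
Qed.

(** Markov's inequality in a form that remains true for m = 0, where the function
    vanishes almost surely. *)
Lemma Rintegral_tail (R : realType) d (S : measurableType d) (Q : probability S R)
    (f : S -> R) (m x : R) : measurable_fun setT f -> Q.-integrable setT (EFin \o f) ->
  (forall s, 0 <= f s) -> \int[Q]_s f s <= m -> 0 < x ->
  (Q [set s | (x * m < f s)%R] <= (1 / x)%:E)%E.
Proof.
move=> mf fi f0 If x0.
have If0 : 0 <= \int[Q]_s f s by apply: Rintegral_ge0.
(* Markov's inequality divides by x m. *)
have [m0|m0] := eqVneq m 0.
  rewrite m0 mulr0 Rintegral0_null//; first by rewrite lee_fin divr_ge0// ltW.
  by apply/eqP; rewrite eq_le If0 andbT -m0.
have mpos : 0 < m by rewrite lt_def m0 (le_trans If0 If).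
have xm0 : 0 < x * m by rewrite mulr_gt0.
apply: (@le_trans _ _ (Q [set s | (x * m <= f s)%R])).
  apply: le_measure; rewrite ?inE.
  - exact: measurable_set_lt.
  - exact: measurable_set_le.
  - by move=> s /= /ltW.
apply: le_trans (markov_Rintegral mf fi f0 xm0) _.
by rewrite lee_fin ler_pdivrMr// mulrA div1r mulVf ?gt_eqF// mul1r.
Qed.

(** * Counting hits uniformly over a family of sets *)

(** The columns of p are the sample and the ghost sample, and e exchanges them
    independently at each index.  The indicator of few hits in the first column
    and many in the second is at most
    exp (lam (a - first) + th (second - b)); its average over e factorizes over
    the indices, and each factor is at most 1: an index with two equal bits
    contributes exp 0 or exp (th - lam), an index with different bits the mean of
    exp th and exp (- lam). *)
Lemma swap_count_bound (R : realType) (N : nat) (p : 'I_N -> bool -> bool)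
    (a b lam th : R) :
  0 <= lam -> 0 <= th -> th <= lam -> expR th + expR (- lam) <= 2 ->
  \sum_(e : {ffun 'I_N -> bool})
     ((\sum_(i < N) (p i (e i))%:R < a) && (b <= \sum_(i < N) (p i (~~ e i))%:R))%:R
  <= 2 ^+ N * expR (lam * a - th * b).
Proof.
move=> lam0 th0 thlam hle.
pose g i c := expR (th * (p i (~~ c))%:R - lam * (p i c)%:R).
apply: (@le_trans _ _ (\sum_(e : {ffun 'I_N -> bool})
    (\prod_(i < N) g i (e i)) * expR (lam * a - th * b))).
  apply: ler_sum => e _.
  rewrite -expR_sum -expRD.
  have [/andP[h1 h2]|_] := boolP (_ && _); last by rewrite expR_ge0.
  rewrite -[leLHS]expR0 ler_expR sumrB -!mulr_sumr.
  have := ler_wpM2l lam0 (ltW h1); have := ler_wpM2l th0 h2; lra.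
rewrite -mulr_suml ler_wpM2r ?expR_ge0//.
rewrite -(bigA_distr_bigA g).
rewrite (_ : 2 ^+ N = \prod_(i < N) 2); last by rewrite prodr_const card_ord.
apply: ler_prod => i _; rewrite sumr_ge0 => [|c _]; last exact: expR_ge0.
rewrite big_bool /g /=.
case: (p i true); case: (p i false); rewrite /= ?mulr0 ?mulr1 ?subr0 ?sub0r ?expR0//.
- have : expR (th - lam) <= 1 by rewrite -expR0 ler_expR subr_le0.
  lra.
- by rewrite addrC.
Qed.

Definition rectangles (I : Type) d (U : measurableType d) : set (set (I -> U)) :=
  [set E | exists2 A : I -> set U, (forall i, measurable (A i)) &
     E = [set x | forall i, A i (x i)]].

Arguments rectangles I {d} U.

(** Families of points with the sigma-algebra generated by rectangles, on which the
    joint law of the sample and the ghost sample is determined. *)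
Definition cyl (I : Type) d (U : measurableType d) :=
  g_sigma_algebraType (rectangles I U).

Lemma setI_closed_rectangles (I : Type) d (U : measurableType d) :
  setI_closed (rectangles I U).
Proof.
move=> _ _ [A mA ->] [B mB ->]; exists (fun i => A i `&` B i).
  by move=> i; exact: measurableI.
apply/seteqP; split => x /=; first by case=> hA hB i; split.
by move=> h; split=> i; case: (h i).
Qed.

Lemma measurable_coordinate (I : choiceType) d (U : measurableType d) (i : I) :
  measurable_fun [set: cyl I U] (fun x : cyl I U => (x : I -> U) i).
Proof.
move=> _ B mB; rewrite setTI; apply: sub_sigma_algebra.
exists (fun j => if j == i then B else setT); first by move=> j; case: ifP.
apply/seteqP; split => x /=; first by move=> Bx j; case: eqP => [->|].
by move=> /(_ i); rewrite eqxx.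
Qed.

Lemma measurable_cyl d (T : measurableType d) (I : finType) d' (U : measurableType d')
    (V : I -> T -> U) : (forall i, measurable_fun setT (V i)) ->
  measurable_fun setT (fun w => (V^~ w) : cyl I U).
Proof.
move=> mV; apply: (@measurability _ _ T (cyl I U) setT _ (rectangles I U)) => //.
move=> _ [_ [A mA ->] <-]; rewrite setTI.
rewrite (_ : _ @^-1` _ = \bigcap_(i in [set: I]) (V i @^-1` A i)).
  apply: fin_bigcap_measurable => //.
  by move=> i _; rewrite -[X in measurable X]setTI; exact: mV.
by apply/seteqP; split => w /=; [move=> h i _; exact: h | move=> h i; exact: h].
Qed.

(** Rectangles are stable under intersection and generate, so two families of
    variables giving them the same probabilities have the same joint law. *)
Lemma law_unique (R : realType) d (T : measurableType d) (P : {measure set T -> \bar R})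
    (I : finType) d' (U : measurableType d') (V V' : I -> T -> U) :
  (P setT < +oo)%E ->
  (forall i, measurable_fun setT (V i)) -> (forall i, measurable_fun setT (V' i)) ->
  (forall A : I -> set U, (forall i, measurable (A i)) ->
     P [set w | forall i, A i (V i w)] = P [set w | forall i, A i (V' i w)]) ->
  forall E : set (cyl I U), measurable E ->
    P ((fun w => V^~ w : cyl I U) @^-1` E) = P ((fun w => V'^~ w : cyl I U) @^-1` E).
Proof.
move=> Poo mV mV' VV' E mE.
pose X := mfun_of (measurable_cyl mV); pose X' := mfun_of (measurable_cyl mV').
apply: (@measure_unique _ R (cyl I U) (rectangles I U) (fun=> setT) erefl
  (@setI_closed_rectangles I d' U) _ _ (pushforward P X) (pushforward P X')) => //.
- move=> _; exists (fun=> setT) => //.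
  by apply/seteqP; split.
- by rewrite bigcup_const//; exists 0%N.
- by move=> _ [A mA ->]; exact: VV'.
Qed.

Section uniform_count.
Context (R : realType) d d1 d2 (T : measurableType d) (S : measurableType d1)
  (U : measurableType d2) (P : probability T R) (Q : probability S R).
Variables (N : nat) (X : 'I_N -> S -> U) (g : T -> U) (A : nat -> set U).
Variables (a b G : R).
Hypothesis mX : forall i, measurable_fun setT (X i).
Hypothesis lawX : forall i B, measurable B -> Q (X i @^-1` B) = P (g @^-1` B).
Hypothesis indX : forall B : 'I_N -> set U, (forall i, measurable (B i)) ->
  Q [set s | forall i, B i (X i s)] = (\prod_(i < N) Q (X i @^-1` B i))%E.
Hypothesis mA : forall k, measurable (A k).
Hypothesis growth : forall (x : 'I_N * bool -> U) (L : seq {ffun 'I_N * bool -> bool}),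
  uniq L -> (forall p, p \in L -> exists k, p = [ffun j => x j \in A k]) ->
  (size L)%:R <= G.

Let count k s : R := \sum_(i < N) \1_(A k) (X i s).

Let mcount k : measurable_fun setT (count k).
Proof. by apply: measurable_sum => i; apply: measurableT_comp. Qed.

Let C : set (cyl ('I_N * bool)%type U) := \bigcup_k
  [set x | (\sum_(i < N) \1_(A k) (x (i, false)) < a) /\
           (b <= \sum_(i < N) \1_(A k) (x (i, true)))].

Let mC : measurable C.
Proof.
apply: bigcupT_measurable => k.
have m1 c : measurable_fun setT
    (fun x : cyl ('I_N * bool)%type U => \sum_(i < N) (\1_(A k) ((x : _ -> U) (i, c)) : R)).
  apply: measurable_sum => i.
  have mi : measurable_fun setT (\1_(A k) : U -> R) by exact: measurable_indic.
  exact: (measurableT_comp mi (measurable_coordinate (i, c))).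
apply: measurableI.
  exact: (measurable_set_lt (m1 false) (measurable_cst a)).
exact: (measurable_set_le (measurable_cst b) (m1 true)).
Qed.

Let W (e : {ffun 'I_N -> bool}) (j : 'I_N * bool) (z : S * S) : U :=
  if j.2 (+) e j.1 then X j.1 z.2 else X j.1 z.1.

Let mW e j : measurable_fun setT (W e j).
Proof.
rewrite /W; case: (j.2 (+) e j.1).
  by apply: measurableT_comp.
by apply: measurableT_comp.
Qed.

Let E e := (fun z => (W e)^~ z : cyl _ U) @^-1` C.

Let mE e : measurable (E e).
Proof.
rewrite -[X in measurable X]setTI; exact: (measurable_cyl (mW e)).
Qed.

Let W_rectangle e (B : 'I_N * bool -> set U) : (forall j, measurable (B j)) ->
  (Q \x Q)%E [set z | forall j, B j (W e j z)] =
  (\prod_(i < N) (P (g @^-1` B (i, false)) * P (g @^-1` B (i, true))))%E.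
Proof.
move=> mB.
rewrite (_ : [set z | _] = [set s | forall i, B (i, e i) (X i s)] `*`
    [set s | forall i, B (i, ~~ e i) (X i s)]); last first.
  apply/seteqP; split => -[s s'] /=.
    move=> h; split => i.
      by have := h (i, e i); rewrite /W /= addbb.
    by have := h (i, ~~ e i); rewrite /W /= addNb addbb.
  move=> [h1 h2] [i c]; rewrite /W /=.
  have [h|h] := boolP (c (+) e i).
    rewrite (_ : c = ~~ e i); first exact: h2.
    by move: h; case: c; case: (e i).
  rewrite (_ : c = e i); first exact: h1.
  by move: h; case: c; case: (e i).
have meas (c : 'I_N -> bool) : measurable [set s | forall i, B (i, c i) (X i s)].
  rewrite (_ : [set s | _] = \bigcap_(i in [set: 'I_N]) (X i @^-1` B (i, c i))).
    apply: fin_bigcap_measurable => // i _.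
    by rewrite -[X in measurable X]setTI; exact: mX.
  by apply/seteqP; split => s /= h i; [move=> _; exact: h|exact: h].
rewrite product_measure1E; [|exact: (meas e)|exact: (meas (fun i => ~~ e i))].
have ind (c : 'I_N -> bool) := @indX (fun i => B (i, c i)) (fun i => mB _).
rewrite [X in (X * _)%E](ind e) [X in (_ * X)%E](ind (fun i => ~~ e i)).
rewrite -big_split /=; apply: eq_bigr => i _.
by rewrite !lawX//; case: (e i) => //=; rewrite muleC.
Qed.

Let QQT : (Q \x Q)%E [set: S * S] = 1%E.
Proof.
transitivity (Q setT * Q setT)%E; last by rewrite probability_setT mule1.
by rewrite -setXTT; exact: product_measure1E.
Qed.

Let E_swap e : (Q \x Q)%E (E e) = (Q \x Q)%E (E [ffun=> false]).
Proof.
apply: (@law_unique _ _ _ (Q \x Q)%E _ _ _ (W e) (W [ffun=> false])) => //.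
- exact: (eq_ind_r (fun t => (t < +oo)%E) (ltry 1) QQT).
- by move=> B mB; exact: etrans (W_rectangle e mB) (esym (W_rectangle _ mB)).
Qed.

(** For fixed samples z, whether a set is bad after the exchange e depends only on
    its trace on the 2 N points; the union bound runs over these traces. *)
Lemma swapped_pattern_bound (lam th : R) : 0 <= lam -> 0 <= th -> th <= lam ->
  expR th + expR (- lam) <= 2 -> forall z,
  \sum_(e : {ffun 'I_N -> bool}) \1_(E e) z <=
  2 ^+ N * (G * expR (lam * a - th * b)).
Proof.
move=> lam0 th0 thlam hle z.
pose x j := W [ffun=> false] j z.
pose bad (p : {ffun 'I_N * bool -> bool}) (e : {ffun 'I_N -> bool}) : bool :=
  (\sum_(i < N) (p (i, e i))%:R < a) && (b <= \sum_(i < N) (p (i, ~~ e i))%:R).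
pose real p := `[< exists k, p = [ffun j => x j \in A k] >].
pose L := [seq p <- enum {: {ffun 'I_N * bool -> bool}} | real p].
have Wx e i c : W e (i, c) z = x (i, c (+) e i) by rewrite /x /W /= ffunE addbF.
apply: (@le_trans _ _ (\sum_(e : {ffun 'I_N -> bool}) \sum_(p <- L) (bad p e)%:R)).
  apply: ler_sum => e _; rewrite indicE.
  have [|_] := boolP (z \in E e); last by apply: sumr_ge0 => p _; rewrite ler0n.
  rewrite inE => -[k _ [h1 h2]].
  pose p := [ffun j => x j \in A k].
  have pL : p \in L by rewrite mem_filter mem_enum inE andbT; apply/asboolP; exists k.
  rewrite (big_rem p)//= (_ : bad p e); last first.
    apply/andP; split.
      apply: le_lt_trans h1; apply: ler_sum => i _.
      by rewrite indicE /= Wx ffunE.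
    apply: (le_trans h2); apply: ler_sum => i _.
    by rewrite indicE /= Wx ffunE.
  by rewrite lerDl; apply: sumr_ge0 => q _; rewrite ler0n.
rewrite exchange_big /= [leRHS]mulrCA.
apply: (@le_trans _ _ (\sum_(p <- L) 2 ^+ N * expR (lam * a - th * b))).
  apply: ler_sum => p _.
  exact: (@swap_count_bound _ _ (fun i c => p (i, c))).
rewrite big_const_seq count_predT iter_addr_0 -[leLHS]mulr_natl.
rewrite ler_wpM2r ?mulr_ge0 ?expR_ge0 ?exprn_ge0//.
apply: (growth (x := x)); first by rewrite filter_uniq// enum_uniq.
by move=> p; rewrite mem_filter => /andP[/asboolP].
Qed.

(** Exchanging coordinates preserves the product law, so the probability of the
    event is its average over all exchanges. *)
Lemma ghost_sample_bound (lam th : R) : 0 <= lam -> 0 <= th -> th <= lam ->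
  expR th + expR (- lam) <= 2 ->
  ((Q \x Q)%E (E [ffun=> false]) <= (G * expR (lam * a - th * b))%:E)%E.
Proof.
move=> lam0 th0 thlam hle.
have h := swapped_pattern_bound lam0 th0 thlam hle.
have c0 : (0 < (2 ^+ N)%:E :> \bar R)%E by rewrite lte_fin exprn_gt0.
rewrite -(lee_pmul2l _ c0)// -EFinM.
apply: (@le_trans _ _
  (\int[(Q \x Q)%E]_z (\sum_(e : {ffun 'I_N -> bool}) (\1_(E e) z)%:E)%E)%E).
  rewrite ge0_integral_sum//; last first.
    by move=> e; apply/measurable_EFinP; exact: measurable_indic.
  rewrite (eq_bigr (fun=> (Q \x Q)%E (E [ffun=> false]))) => [|e _]; last first.
    by rewrite integral_indic// setIT; exact: E_swap.
  by rewrite sumr_const card_ffun card_bool card_ord -natrX mule_natl.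
apply: (@le_trans _ _
  (\int[(Q \x Q)%E]_z (cst (2 ^+ N * (G * expR (lam * a - th * b)))%:E z))%E).
  apply: ge0_le_integral => //.
  - by move=> z _; apply: sume_ge0 => e _; rewrite lee_fin.
  - apply: emeasurable_sum => e; apply/measurable_EFinP; exact: measurable_indic.
  - by move=> z _; rewrite sumEFin lee_fin.
rewrite integral_cst//.
rewrite le_eqVlt; apply/orP; left; apply/eqP.
exact: etrans (congr1 (mule (2 ^+ N * (G * expR (lam * a - th * b)))%:E) QQT) (mule1 _).
Qed.

(** If some set of the family has few hits in the sample then, for a fixed sample,
    that same set has many hits in an independent ghost sample with probability
    at least 15/16. *)
Lemma count_lower_tail_ghost (lam th : R) : 0 <= lam -> 0 <= th -> th <= lam ->
  expR th + expR (- lam) <= 2 ->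
  (forall k, Q [set s | (count k s < b)%R] <= (16^-1)%:E)%E ->
  (Q (\bigcup_k [set s | (count k s < a)%R]) <=
    (16 / 15 * (G * expR (lam * a - th * b)))%:E)%E.
Proof.
move=> lam0 th0 thlam hle hcheb.
set B := \bigcup_k _.
have mB : measurable B.
  by apply: bigcupT_measurable => k; exact: measurable_set_lt.
have c0 : (0 < (15 / 16)%:E :> \bar R)%E by rewrite lte_fin.
rewrite -(lee_pmul2l _ c0)// -EFinM.
rewrite (_ : 15 / 16 * _ = G * expR (lam * a - th * b)); last by field.
apply: le_trans (ghost_sample_bound lam0 th0 thlam hle).
rewrite /product_measure1.
apply: (@le_trans _ _ (\int[Q]_s ((15 / 16)%:E * (\1_B s)%:E))%E).
  rewrite ge0_integralZl//; last by apply/measurable_EFinP; exact: measurable_indic.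
  by rewrite integral_indic// setIT.
apply: ge0_le_integral => //.
- by apply: measurable_funeM; apply/measurable_EFinP; exact: measurable_indic.
- exact: measurable_fun_xsection.
move=> s _; rewrite indicE; have [|_] := boolP (s \in B); last by rewrite mule0.
rewrite inE mule1 => -[k _ /= hk].
have mlt : measurable [set s | count k s < b] by exact: measurable_set_lt.
apply: (@le_trans _ _ (Q (~` [set s' | count k s' < b]))).
  rewrite probability_setC//.
  have := hcheb k.
  rewrite -[X in (X <= _)%E]fineK ?fin_num_measure//.
  rewrite -[X in (_ <= _ - X)%E]fineK ?fin_num_measure//.
  by rewrite -EFinB !lee_fin; lra.
apply: le_measure; rewrite ?inE.
- exact: measurableC.
- exact: measurable_xsection.
move=> s' /= /negP; rewrite -leNgt => hk'.
rewrite /xsection /= inE; exists k => //=; split.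
  by apply: le_lt_trans hk; apply: ler_sum => i _; rewrite /W /= ffunE.
by apply: (le_trans hk'); apply: ler_sum => i _; rewrite /W /= ffunE.
Qed.

End uniform_count.

(** * Orthonormalisation for a semi-definite form *)

Section semi_inner_product.
Context (R : rcfType) (V : lmodType R).
Variable B : V -> V -> R.
Hypotheses (BC : forall u v, B u v = B v u) (Bge0 : forall u, 0 <= B u u).
Hypothesis Blin : forall a u v w, B (a *: u + v) w = a * B u w + B v w.

Definition orthonormal_seq (es : seq V) : bool :=
  pairwise (fun e f => B e f == 0) es && all (fun e => B e e == 1) es.

(** The component of v orthogonal to an orthonormal sequence. *)
Definition residual (es : seq V) (v : V) : V := v - \sum_(e <- es) B v e *: e.

Let B0 w : B 0 w = 0.
Proof. by have := Blin 1 0 0 w; rewrite scale1r addr0 mul1r; lra. Qed.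

Let BD u v w : B (u + v) w = B u w + B v w.
Proof. by have := Blin 1 u v w; rewrite scale1r mul1r. Qed.

Let BZ a u w : B (a *: u) w = a * B u w.
Proof. by have := Blin a u 0 w; rewrite addr0 B0 addr0. Qed.

Let Bsum (r : seq V) (F : V -> V) w : B (\sum_(e <- r) F e) w = \sum_(e <- r) B (F e) w.
Proof. by elim: r => [|e r IH]; rewrite ?big_nil ?B0// !big_cons BD IH. Qed.

Let Bres es u w : B (residual es u) w = B u w - \sum_(e <- es) B u e * B e w.
Proof.
rewrite /residual BD -scaleN1r BZ Bsum mulN1r; congr (_ - _).
by apply: eq_bigr => e _; rewrite BZ.
Qed.

Lemma residual_orthogonal es v f : orthonormal_seq es -> f \in es -> B (residual es v) f = 0.
Proof.
rewrite Bres; elim: es => // e es IH /andP[/= /andP[/allP he hes] /andP[/eqP e1 h1]].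
rewrite inE big_cons; have [->|fe] /= := eqVneq f e.
  move=> _; rewrite e1 mulr1 big_seq big1 ?addr0 ?subrr// => g ges.
  by rewrite (BC g) (eqP (he _ ges)) mulr0.
move=> fes; rewrite (eqP (he _ fes)) mulr0 add0r; apply: IH => //.
exact/andP.
Qed.

Lemma residual_sqr es v : orthonormal_seq es ->
  B (residual es v) (residual es v) = B v v - \sum_(e <- es) B v e ^+ 2.
Proof.
move=> oes; rewrite {2}/residual BC -scaleN1r addrC.
rewrite Blin Bsum big_seq big1 ?mulr0 ?add0r; last first.
  by move=> e ees; rewrite BZ (BC e) residual_orthogonal ?mulr0.
rewrite BC Bres; congr (_ - _); apply: eq_bigr => e _.
by rewrite (BC e) expr2.
Qed.

Lemma bessel es v : orthonormal_seq es -> \sum_(e <- es) B v e ^+ 2 <= B v v.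
Proof. by move=> oes; rewrite -subr_ge0 -residual_sqr. Qed.

(** The form is only semi-definite: a vector whose residual has norm zero adds no
    element to the sequence, and the conclusion is that residuals are null
    vectors, not that they vanish. *)
Lemma gram_schmidt (l : seq V) : exists es, [/\ (size es <= size l)%N, orthonormal_seq es &
  forall v, v \in l -> B (residual es v) (residual es v) = 0].
Proof.
elim: l => [|v l [es [sz oes hes]]]; first by exists [::].
have [w0|w0] := eqVneq (B (residual es v) (residual es v)) 0.
  exists es; split => //; first exact: leqW.
  by move=> u; rewrite inE => /predU1P[->//|/hes].
pose w := residual es v; rewrite -/w in w0.
have wpos : 0 < B w w by rewrite lt_def w0 Bge0.
pose c := Num.sqrt (B w w); have c0 : 0 < c by rewrite sqrtr_gt0.
have c2 : c * c = B w w by rewrite -expr2 sqr_sqrtr// ltW.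
pose e := c^-1 *: w.
have oe : orthonormal_seq (e :: es).
  move: (oes) => /andP[p1 a1]; rewrite /orthonormal_seq /= p1 a1 !andbT.
  apply/andP; split.
    by apply/allP => f fes; rewrite BZ residual_orthogonal// mulr0.
  rewrite BZ BC BZ -c2; apply/eqP; field; exact: lt0r_neq0.
exists (e :: es); split => //.
move=> u; rewrite inE => /predU1P[->|ul]; rewrite residual_sqr// big_cons.
  have -> : B v e = c.
    rewrite BC BZ -(subrK (\sum_(f <- es) B v f *: f) v) -/(residual es v) -/w.
    rewrite BC BD Bsum big_seq big1 ?addr0 => [|f fes].
      by rewrite -c2 mulKf// lt0r_neq0.
    by rewrite BZ (BC f) residual_orthogonal// mulr0.
  by rewrite expr2 c2 opprD addrCA -residual_sqr// -/w addNr.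
have := hes u ul; rewrite residual_sqr// => h.
have := Bge0 (residual (e :: es) u); rewrite residual_sqr// big_cons.
by have := sqr_ge0 (B u e); lra.
Qed.

End semi_inner_product.

(** * The span of the dictionary in L2 *)

Definition lincomb (R : realType) (U : Type) (M : nat) (F : 'I_M -> U -> R)
  (t : 'rV[R]_M) (u : U) : R := \sum_(j < M) t 0 j * F j u.

Lemma lincombP (R : realType) (U : Type) (M : nat) (F : 'I_M -> U -> R)
  (a : R) (s t : 'rV[R]_M) (u : U) :
  lincomb F (a *: s + t) u = a * lincomb F s u + lincomb F t u.
Proof.
rewrite /lincomb mulr_sumr -big_split; apply: eq_bigr => j _ /=.
by rewrite !mxE; ring.
Qed.

Lemma dict_spanP (R : realType) (U : Type) (M : nat) (F : 'I_M -> U -> R) (f : U -> R) :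
  dict_span F f <-> exists t, f = lincomb F t.
Proof.
split=> [[t ->]|[t ->]]; last by exists (t 0).
by exists (\row_j t j); apply/funext => u; apply: eq_bigr => j _; rewrite mxE.
Qed.

Lemma L2norm_Rintegral (R : realType) d d' (T : measurableType d)
    (U : measurableType d') (P : probability T R) (X : {RV P >-> U}) (f : U -> R) :
  f \o X \in Lfun P 2%:E ->
  L2norm X f = (Num.sqrt (\int[P]_w (f (X w) ^+ 2)))%:E.
Proof.
move=> f2; rewrite /L2norm unlock /Lnorm /=.
rewrite (_ : (\int[P]_x `|(f (X x))%:E| `^ 2)%E = (\int[P]_w (f (X w) ^+ 2))%:E).
  by rewrite poweR_EFin powR12_sqrt// Rintegral_ge0// => w _; rewrite sqr_ge0.
rewrite /Rintegral fineK.
  by apply: eq_integral => w _ /=; rewrite powR_mulrn// real_normK// num_real.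
exact: (integrable_fin_num measurableT (Lfun2_integrable_sqr f2)).
Qed.

Section span_form.
Context (R : realType) d d' (T : measurableType d) (U : measurableType d')
  (P : probability T R).
Variables (X : {RV P >-> U}) (M : nat) (F : 'I_M -> {mfun U >-> R}).
Hypothesis F2 : forall j, F j \o X \in Lfun P 2%:E.

Definition l2form (s t : 'rV[R]_M) : R :=
  \int[P]_w (lincomb F s (X w) * lincomb F t (X w)).

Lemma lincomb_Lfun2 t : lincomb F t \o X \in Lfun P 2%:E.
Proof.
apply: (@Lfun2_sum _ _ _ P _ _ (fun j w => t 0 j * F j (X w))) => j.
rewrite (_ : (fun w => _) = t 0 j \o* (F j \o X)).
  by apply: Lfun_scale => //; rewrite ler1n.
by apply/funext => w /=; rewrite mulrC.
Qed.

Lemma measurable_lincomb t : measurable_fun setT (lincomb F t).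
Proof. by apply: measurable_sum => j; apply: measurable_funM. Qed.

Lemma l2formC s t : l2form s t = l2form t s.
Proof. by apply: eq_Rintegral => w _; rewrite mulrC. Qed.

Lemma l2form_sqr t : l2form t t = \int[P]_w (lincomb F t (X w) ^+ 2).
Proof. by apply: eq_Rintegral => w _; rewrite expr2. Qed.

Lemma l2form_ge0 t : 0 <= l2form t t.
Proof. by rewrite l2form_sqr Rintegral_ge0// => w _; rewrite sqr_ge0. Qed.

Lemma l2form_lin a s t r : l2form (a *: s + t) r = a * l2form s r + l2form t r.
Proof.
rewrite /l2form -RintegralZl//; last by apply: Lfun2_integrableM; exact: lincomb_Lfun2.
rewrite -RintegralD//.
- by apply: eq_Rintegral => w _; rewrite lincombP; ring.
- apply: (eq_integrable measurableT _ _ _ (integrableZl measurableT a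
    (Lfun2_integrableM (lincomb_Lfun2 s) (lincomb_Lfun2 r)))) => // w _ /=.
- by apply: Lfun2_integrableM; exact: lincomb_Lfun2.
Qed.

Lemma L2norm_lincomb t : L2norm X (lincomb F t) = (Num.sqrt (l2form t t))%:E.
Proof. by rewrite L2norm_Rintegral ?l2form_sqr//; exact: lincomb_Lfun2. Qed.

Lemma l2form_coord s t : l2form s t =
  \sum_(j < M) \sum_(k < M) s 0 j * t 0 k * l2form (delta_mx 0 j) (delta_mx 0 k).
Proof.
have l2form_suml (r : 'rV[R]_M) : l2form s r = \sum_(j < M) s 0 j * l2form (delta_mx 0 j) r.
  rewrite {1}[s]row_sum_delta; elim/big_rec2: _ => [|j y x _ <-].
    have := l2form_lin 1 0 0 r; rewrite scale1r addr0 mul1r; lra.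
  by rewrite l2form_lin.
rewrite l2form_suml; apply: eq_bigr => j _.
rewrite l2formC.
have -> : l2form t (delta_mx 0 j) = \sum_(k < M) t 0 k * l2form (delta_mx 0 k) (delta_mx 0 j).
  rewrite {1}[t]row_sum_delta; elim/big_rec2: _ => [|k y x _ <-].
    have := l2form_lin 1 0 0 (delta_mx 0 j); rewrite scale1r addr0 mul1r; lra.
  by rewrite l2form_lin.
by rewrite mulr_sumr; apply: eq_bigr => k _; rewrite l2formC; ring.
Qed.

End span_form.

(** Strict positivity is an open condition, and rational rows are dense. *)
Lemma rational_row_approx (R : realType) (M n : nat) (D : 'I_n -> 'rV[R]_M -> R)
    (t : 'rV[R]_M) : (forall i, {for t, continuous (D i)}) ->
  exists r : 'rV[rat]_M, forall i, 0 < D i t -> 0 < D i (map_mx ratr r).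
Proof.
move=> cD.
have near_pos : \forall t' \near t, forall i, 0 < D i t -> 0 < D i t'.
  apply: (@filter_forall 'rV[R]_M 'I_n
    (fun i t' => 0 < D i t -> 0 < D i t') (nbhs t)) => i.
  have [Dt|_] := boolP (0 < D i t); last by near=> t'.
  by near=> t' => _; near: t'; exact: (cvgr_gt _ (cD i) _ Dt).
move/nbhs_ballP : near_pos => [e /= e0 te].
have ch (j : 'I_M) : exists q : rat, t 0 j < ratr q < t 0 j + e.
  have /rat_in_itvoo[q] : t 0 j < t 0 j + e by rewrite ltrDl.
  by rewrite in_itv /= => h; exists q.
have [q hq] := choice ch.
exists (\row_j q j); apply: te; split => // i j.
rewrite !mxE ord1 /ball /=; have /andP[h1 h2] := hq j.
by rewrite ltr_distl; apply/andP; split; lra.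
Unshelve. all: by end_near. Qed.

Section approx_form.
Context (R : realType) d d' (T : measurableType d) (U : measurableType d')
  (P : probability T R).
Variables (X : {RV P >-> U}) (M : nat) (F : 'I_M -> {mfun U >-> R}).
Hypothesis F2 : forall j, F j \o X \in Lfun P 2%:E.

Lemma continuous_lincomb (u : U) : continuous (fun t : 'rV[R]_M => lincomb F t u).
Proof.
apply: continuous_big => [|j _ t]; first exact: add_continuous.
apply: cvgM; first exact: nbhs_filter.
  exact: (@coord_continuous R 1 M 0 j t).
by apply: cvg_cst; exact: nbhs_filter.
Qed.

Lemma continuous_l2form : continuous (fun t : 'rV[R]_M => l2form X F t t).
Proof.
rewrite (_ : (fun t => _) = fun t : 'rV[R]_M => \sum_(j < M) \sum_(k < M)
    t 0 j * t 0 k * l2form X F (delta_mx 0 j) (delta_mx 0 k)); last first.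
  by apply/funext => t; rewrite l2form_coord.
apply: continuous_big => [|j _]; first exact: add_continuous.
apply: continuous_big => [|k _ t]; first exact: add_continuous.
apply: cvgM; [exact: nbhs_filter | | by apply: cvg_cst; exact: nbhs_filter].
apply: cvgM; first exact: nbhs_filter.
  exact: (@coord_continuous R 1 M 0 j t).
exact: (@coord_continuous R 1 M 0 k t).
Qed.

Lemma slab_gap (kappa : R) (t : 'rV[R]_M) (u : U) : 0 < kappa ->
  (`|lincomb F t u| < kappa * Num.sqrt (l2form X F t t)) =
  (0 < kappa ^+ 2 * l2form X F t t - lincomb F t u ^+ 2).
Proof.
move=> k0; rewrite subr_gt0 -[X in _ = (_ < _ * X)](sqr_sqrtr (l2form_ge0 X F t)).
rewrite -exprMn -[in RHS](real_normK (num_real (lincomb F t u))) ltr_pXn2r//.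
by rewrite nnegrE mulr_ge0// ltW.
Qed.

Lemma rational_slab (kappa : R) (n : nat) (x : 'I_n -> U) (t : 'rV[R]_M) : 0 < kappa ->
  exists r : 'rV[rat]_M, let t' := map_mx ratr r in forall i,
   `|lincomb F t (x i)| < kappa * Num.sqrt (l2form X F t t) ->
   `|lincomb F t' (x i)| < kappa * Num.sqrt (l2form X F t' t').
Proof.
move=> k0.
pose D i (t : 'rV[R]_M) := kappa ^+ 2 * l2form X F t t - lincomb F t (x i) ^+ 2.
have [|r hr] := @rational_row_approx _ _ _ D t.
  move=> i; apply: cvgB; first exact: nbhs_filter.
    apply: cvgM; [exact: nbhs_filter | | exact: continuous_l2form].
    by apply: cvg_cst; exact: nbhs_filter.
  rewrite expr2; apply: cvgM; first exact: nbhs_filter.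
    exact: continuous_lincomb.
  exact: continuous_lincomb.
by exists r => /= i; rewrite !slab_gap//; exact: hr.
Qed.

End approx_form.

(** * The small-ball event on the sample *)

(** The exponents 1 and 9/20 are the ones used in [swap_count_bound]; they are
    chosen so that 9/20 * 99/100 - 1/8 exceeds 1/4 with room for the entropy term. *)
Lemma swap_exponents (R : realType) : expR (9 / 20) + expR (- 1) <= 2 :> R.
Proof.
(* From 1 - u <= exp (- u) at u = 1/20; taking powers in two stages keeps the
   numerators small. *)
have h0 : expR 20^-1 <= 20 / 19 :> R.
  rewrite -[20^-1]opprK expRN -[leRHS]invrK lef_pV2 ?posrE ?expR_gt0//.
  by apply: le_trans (expR_ge1Dx _); lra.
have h03 : expR 20^-1 ^+ 3 <= 7 / 6 :> R.
  apply: (@le_trans _ _ ((20 / 19) ^+ 3)); last by lra.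
  by apply: lerXn2r; rewrite ?nnegrE ?expR_ge0.
have h1 : expR (9 / 20) <= (7 / 6) ^+ 3 :> R.
  have -> : expR (9 / 20) = (expR 20^-1 ^+ 3) ^+ 3 :> R by rewrite -exprM -expRM_natl.
  by apply: lerXn2r; rewrite ?nnegrE ?exprn_ge0 ?expR_ge0.
have h2 : expR (- 1) <= (4 / 5) ^+ 4 :> R.
  have -> : expR (- 1) = expR (- 4^-1) ^+ 4 :> R.
    by rewrite -expRM_natl; congr expR; field.
  apply: lerXn2r; rewrite ?nnegrE ?expR_ge0//.
  rewrite expRN -[leRHS]invrK lef_pV2 ?posrE ?expR_gt0//.
  by apply: le_trans (expR_ge1Dx _); lra.
have h3 : (7 / 6) ^+ 3 + (4 / 5) ^+ 4 <= 2 :> R by lra.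
lra.
Qed.

(** Every factor is bounded by an exponential of a multiple of beta N.  The
    multiples add up to 1/1000 + 1/400 + 1/50 + 1/8 - 9/20 * 99/100 < - 1/4.
    The sample size enters through M / beta <= beta N / 400^2, which turns the
    factor (200 / beta)^(M + 1) into a term of that form. *)
Lemma small_ball_exponent (R : realType) (M N : nat) (beta : R) : (0 < M)%N ->
  0 < beta -> beta <= 1 -> 400 ^+ 2 * M%:R / beta ^+ 2 <= N%:R ->
  16 / 15 * (((beta / 200)^-1 ^+ M.+1 * (1 + beta / 200) ^+ (2 * (2 * N))) *
    expR (1 * (beta * N%:R / 8) - 9 / 20 * (99 / 100 * (N%:R * beta))))
  <= expR (- (beta ^+ 2 * N%:R / 4)).
Proof.
move=> M0 b0 b1 hN.
have M1 : 1 <= M%:R :> R by rewrite ler1n.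
have hMN : 400 * (400 * M%:R) <= beta ^+ 2 * N%:R.
  by move: hN; rewrite ler_pdivrMr ?exprn_gt0//; lra.
have bbN : beta ^+ 2 * N%:R <= beta * N%:R.
  by rewrite ler_wpM2r// expr2 ler_piMl// ltW.
have e1 : 16 / 15 <= expR (beta * N%:R / 1000).
  by apply: le_trans (expR_ge1Dx _); lra.
have e2 : (beta / 200)^-1 ^+ M.+1 <= expR (beta * N%:R / 400).
  apply: (@le_trans _ _ (expR (M.+1%:R * (beta / 200)^-1))).
    rewrite expRM_natl; apply: lerXn2r; rewrite ?nnegrE ?expR_ge0//.
      by rewrite invr_ge0 divr_ge0// ltW.
    by apply: le_trans (expR_ge1Dx _); lra.
  rewrite ler_expR invf_div mulrA ler_pdivrMr//.
  have : M.+1%:R <= 2 * M%:R :> R by rewrite -natr1; lra.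
  have -> : beta * N%:R / 400 * beta = beta ^+ 2 * N%:R / 400 by field.
  lra.
have e3 : (1 + beta / 200) ^+ (2 * (2 * N)) <= expR (beta * N%:R / 50).
  rewrite (_ : beta * N%:R / 50 = (2 * (2 * N))%:R * (beta / 200)); last first.
    by rewrite !natrM; field.
  rewrite expRM_natl; apply: lerXn2r; rewrite ?nnegrE ?expR_ge0 ?expR_ge1Dx//.
  by rewrite addr_ge0// divr_ge0// ltW.
have y0 : 0 <= (beta / 200)^-1 by rewrite invr_ge0 divr_ge0// ltW.
have y1 : 0 <= 1 + beta / 200 by rewrite addr_ge0// divr_ge0// ltW.
apply: (@le_trans _ _ (expR (beta * N%:R / 1000) * ((expR (beta * N%:R / 400) *
   expR (beta * N%:R / 50)) *
    expR (1 * (beta * N%:R / 8) - 9 / 20 * (99 / 100 * (N%:R * beta)))))).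
  apply: ler_pM => //.
    by rewrite !mulr_ge0 ?exprn_ge0 ?expR_ge0.
  by rewrite ler_wpM2r ?expR_ge0// ler_pM ?exprn_ge0.
rewrite -!expRD ler_expR.
lra.
Qed.

Lemma mutually_independent_pair (R : realType) d d' (S : measurableType d)
    (V : measurableType d') (Q : probability S R) (N : nat) (Z : 'I_N -> {RV Q >-> V}) :
  mutually_independent Z -> forall i j, i != j ->
  forall A B, measurable A -> measurable B ->
  Q (Z i @^-1` A `&` Z j @^-1` B) = (Q (Z i @^-1` A) * Q (Z j @^-1` B))%E.
Proof.
move=> indZ i j ij A B mA mB.
pose C k := if k == i then A else B.
have Ci : C i = A by rewrite /C eqxx.
have Cj : C j = B by rewrite /C eq_sym (negbTE ij).
have := indZ [set i; j]%SET C; rewrite big_setU1 ?inE//= big_set1 Ci Cj => <-.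
  congr (Q _); apply/seteqP; split => s /=.
    by move=> [sA sB] k /=; rewrite !inE => /orP[/eqP->|/eqP->]; rewrite ?Ci ?Cj.
  move=> h; split; first by rewrite -Ci; apply: (h i) => /=; rewrite !inE eqxx.
  by rewrite -Cj; apply: (h j) => /=; rewrite !inE eqxx orbT.
by move=> k; rewrite /C; case: ifP.
Qed.

Lemma mutually_independent_all (R : realType) d d' (S : measurableType d)
    (V : measurableType d') (Q : probability S R) (N : nat) (Z : 'I_N -> {RV Q >-> V}) :
  mutually_independent Z -> forall A : 'I_N -> set V, (forall i, measurable (A i)) ->
  Q [set s | forall i, A i (Z i s)] = (\prod_(i < N) Q (Z i @^-1` A i))%E.
Proof.
move=> indZ A mA; have := indZ [set: 'I_N]%SET A mA.
rewrite (eq_bigl xpredT) => [<-|i]; last by rewrite inE.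
congr (Q _); apply/seteqP; split => s /= h i; first by move=> _; exact: h.
by apply: h => /=; rewrite inE.
Qed.

Section small_ball.
Context (R : realType) dU dT dS (U : measurableType dU) (T : measurableType dT)
  (S : measurableType dS) (P : probability T R) (Q : probability S R).
Variables (X : {RV P >-> U}) (M N : nat) (F : 'I_M -> {mfun U >-> R}).
Variables (Xs : 'I_N -> S -> U) (kappa beta : R).
Hypothesis F2 : forall j, F j \o X \in Lfun P 2%:E.
Hypothesis (kappa0 : 0 < kappa) (beta0 : 0 < beta) (M0 : (0 < M)%N).
Hypothesis hsmallball : forall f, dict_span F f ->
  (beta%:E <= P [set w | kappa%:E * L2norm X f <= `|f (X w)|%:E])%E.
Hypothesis hN : 400 ^+ 2 * M%:R / beta ^+ 2 <= N%:R.
Hypothesis mXs : forall i, measurable_fun setT (Xs i).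
Hypothesis lawXs : forall i B, measurable B -> Q (Xs i @^-1` B) = P (X @^-1` B).
Hypothesis indXs : forall B : 'I_N -> set U, (forall i, measurable (B i)) ->
  Q [set s | forall i, B i (Xs i s)] = (\prod_(i < N) Q (Xs i @^-1` B i))%E.
Hypothesis pairXs : forall i j, i != j -> forall A B, measurable A -> measurable B ->
  Q (Xs i @^-1` A `&` Xs j @^-1` B) = (Q (Xs i @^-1` A) * Q (Xs j @^-1` B))%E.

Let slab (t : 'rV[R]_M) : set U :=
  [set u | kappa * Num.sqrt (l2form X F t t) <= `|lincomb F t u|].

Let mslab t : measurable (slab t).
Proof.
apply: measurable_set_le => //; apply: measurableT_comp => //.
exact: measurable_lincomb.
Qed.

Let slab_prob t : (beta%:E <= P (X @^-1` slab t))%E.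
Proof.
have /hsmallball : dict_span F (lincomb F t) by apply/dict_spanP; exists t.
rewrite L2norm_lincomb// -EFinM => /le_trans; apply.
Qed.

Let beta1 : beta <= 1.
Proof.
rewrite -lee_fin; apply: (le_trans (slab_prob 0)); apply: probability_le1.
by rewrite -[X in measurable X]setTI; exact: measurable_funPT.
Qed.

Let rat_slab (k : nat) : set U :=
  slab (map_mx ratr (odflt 0 (unpickle k : option 'rV[rat]_M))).

Let Nbeta : 400 * (400 * M%:R) <= N%:R * beta.
Proof.
apply: (@le_trans _ _ (N%:R * beta ^+ 2)).
  by move: hN; rewrite ler_pdivrMr ?exprn_gt0//; lra.
by rewrite ler_wpM2l// expr2 ler_piMl// ltW.
Qed.

Let growth (x : 'I_N * bool -> U) (L : seq {ffun 'I_N * bool -> bool}) : uniq L ->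
  (forall p, p \in L -> exists k, p = [ffun j => x j \in rat_slab k]) ->
  (size L)%:R <= (beta / 200)^-1 ^+ M.+1 * (1 + beta / 200) ^+ (2 * (2 * N)).
Proof.
move=> uL hL.
have y0 : 0 < beta / 200 by rewrite divr_gt0.
have y1 : beta / 200 <= 1.
  by rewrite ler_pdivrMr // mul1r; apply: le_trans beta1 _; rewrite ler1n.
have card2N : #|{: 'I_N * bool}| = (2 * N)%N by rewrite card_prod card_ord card_bool mulnC.
rewrite -card2N.
(* The weight y = beta / 200 balances the two factors of the pattern count. *)
apply: (slab_pattern_count y0 y1 (x := fun j => \col_k F k (x j)) uL) => p /hL[k ->].
set t : 'rV[R]_M := map_mx ratr (odflt 0 (unpickle k : option 'rV[rat]_M)).
exists t, (kappa * Num.sqrt (l2form X F t t)); apply/ffunP => j; rewrite !ffunE.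
rewrite (_ : (t *m _) 0 0 = lincomb F t (x j)); first by rewrite mem_setE.
by rewrite mxE; apply: eq_bigr => i _; rewrite !mxE.
Qed.

Let count_cheb k :
  (Q [set s | (\sum_(i < N) \1_(rat_slab k) (Xs i s) < 99 / 100 * (N%:R * beta))%R] <=
   (16^-1)%:E)%E.
Proof.
pose p := fine (P (X @^-1` rat_slab k)).
have mpre : measurable (X @^-1` rat_slab k).
  by rewrite -[X in measurable X]setTI; apply: measurable_funPT => //; exact: mslab.
have pE : P (X @^-1` rat_slab k) = p%:E by rewrite fineK// fin_num_measure.
have bp : beta <= p by rewrite -lee_fin -pE; exact: slab_prob.
have Nbp : N%:R * beta <= N%:R * p by rewrite ler_wpM2l.
have M1 : 1 <= M%:R :> R by rewrite ler1n.
have NB := Nbeta.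
have lt : 99 / 100 * (N%:R * beta) < N%:R * p by lra.
have mX : measurable_fun setT X by exact: measurable_funPT.
have := @iid_count_lower_tail _ _ _ _ T S U P Q N Xs X mXs mX lawXs pairXs
  (rat_slab k) p _ (mslab _) pE lt.
move=> /le_trans; apply.
rewrite lee_fin ler_pdivrMr; last by rewrite exprn_gt0// subr_gt0.
set m := N%:R * p in Nbp *.
have h : (m / 100) ^+ 2 <= (m - 99 / 100 * (N%:R * beta)) ^+ 2.
  by apply: lerXn2r; rewrite ?nnegrE; lra.
(* This is m >= 400^2, which the assumption on the sample size gives as M >= 1. *)
have h' : 16 * m <= (m / 100) ^+ 2.
  rewrite expr2 (_ : m / 100 * (m / 100) = m * (m / (100 * 100))); last by field.
  rewrite mulrC ler_wpM2l//; first by lra.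
  by rewrite ler_pdivlMr; lra.
lra.
Qed.

(** The threshold beta N / 8 on the number of hits is what the constant 16 of the
    risk bound leaves room for. *)
Lemma small_ball_sample : exists B, [/\ measurable B,
  (Q B <= (expR (- (beta ^+ 2 * N%:R / 4)))%:E)%E
  &
  forall s, ~ B s -> forall t, beta * N%:R / 8 <=
    \sum_(i < N) (kappa * Num.sqrt (l2form X F t t) <= `|lincomb F t (Xs i s)|)%R%:R].
Proof.
pose a := beta * N%:R / 8.
exists (\bigcup_k [set s | \sum_(i < N) \1_(rat_slab k) (Xs i s) < a]); split.
- apply: bigcupT_measurable => k; apply: measurable_set_lt => //.
  apply: measurable_sum => i.
  have mi : measurable_fun setT (\1_(rat_slab k) : U -> R) by exact/measurable_indic/mslab.
  exact: (measurableT_comp mi).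
- have th0 : 0 <= 9 / 20 :> R by lra.
  have th1 : 9 / 20 <= 1 :> R by lra.
  have := @count_lower_tail_ghost _ _ _ _ _ _ _ P Q N Xs X rat_slab a
    (99 / 100 * (N%:R * beta)) _ mXs lawXs indXs (fun k => mslab _) growth
    1 (9 / 20) ler01 th0 th1 (swap_exponents R) count_cheb.
  move=> /le_trans; apply; rewrite lee_fin.
  exact: small_ball_exponent.
move=> s Bs t; rewrite leNgt; apply/negP => lt_a; apply: Bs.
(* Passing to nearby rational coefficients can only lower the number of hits. *)
have [r hr] := rational_slab F2 (fun i => Xs i s) t kappa0.
exists (pickle r) => //=; apply: le_lt_trans lt_a.
apply: ler_sum => i _; rewrite indicE /rat_slab pickleK /=.
have [_|lt_t] := leP (kappa * Num.sqrt (l2form X F t t)) `|lincomb F t (Xs i s)|.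
  by rewrite lern1 leq_b1.
rewrite (_ : _ \in _ = false)//; apply/negbTE; rewrite notin_setE /slab /= => le_r.
by have := hr i lt_t; rewrite ltNge le_r.
Qed.

End small_ball.

(** * The noise process *)

Section noise.
Context (R : realType) d d' (T : measurableType d) (U : measurableType d')
  (P : probability T R).
Variables (X : {RV P >-> U}) (zeta : {RV P >-> R}) (h : U -> R) (sigma : R).
Hypothesis hmean : 'E_P[zeta]%E = 0%E.
Hypothesis hindep : independent_RVs zeta X.
Hypothesis hL2 : (zeta : T -> R) \in Lfun P 2%:E.
Hypothesis hsigma : 'E_P[(fun w => zeta w ^+ 2)%R]%E = (sigma ^+ 2)%:E.
Hypothesis (mh : measurable_fun setT h) (h2 : h \o X \in Lfun P 2%:E).

Let mzeta : measurable_fun setT zeta. Proof. exact: measurable_funPT. Qed.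
Let mX : measurable_fun setT X. Proof. exact: measurable_funPT. Qed.
Let msq : measurable_fun setT (fun x : R => x ^+ 2). Proof. exact: measurable_funX. Qed.
Let msqh : measurable_fun setT (fun u => h u ^+ 2). Proof. exact: measurable_funX. Qed.

Lemma noise_Lfun2 : (fun w => zeta w * h (X w)) \in Lfun P 2%:E.
Proof.
apply: Lfun2_of_sqr; first by apply: measurable_funM => //; exact: measurableT_comp.
under [X in P.-integrable _ X]eq_fun do rewrite /= exprMn.
apply: (integrable_indep mzeta mX hindep msq msqh); exact: Lfun2_integrable_sqr.
Qed.

Lemma noise_mean : \int[P]_w (zeta w * h (X w)) = 0.
Proof.
rewrite (integral_indep mzeta mX hindep (@measurable_id _ _ setT) mh).
- rewrite (_ : \int[P]_w zeta w = 0) ?mul0r//.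
  by move: hmean; rewrite unlock /Rintegral => ->.
- exact: Lfun2_integrable.
- exact: Lfun2_integrable.
Qed.

Lemma noise_variance :
  \int[P]_w ((zeta w * h (X w)) ^+ 2) = sigma ^+ 2 * \int[P]_w (h (X w) ^+ 2).
Proof.
under eq_Rintegral do rewrite exprMn.
rewrite (integral_indep mzeta mX hindep msq msqh); try exact: Lfun2_integrable_sqr.
by congr (_ * _); move: hsigma; rewrite unlock /Rintegral => ->.
Qed.

End noise.

Section noise_process.
Context (R : realType) dU dT dS (U : measurableType dU) (T : measurableType dT)
  (S : measurableType dS) (P : probability T R) (Q : probability S R).
Variables (X : {RV P >-> U}) (Y zeta : {RV P >-> R}) (M N : nat).
Variables (F : 'I_M -> {mfun U >-> R}) (fstar : U -> R).
Variables (Z : 'I_N -> {RV Q >-> (U * R)%type}) (sigma : R).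
Hypothesis F2 : forall j, F j \o X \in Lfun P 2%:E.
Hypothesis hY : forall w, Y w = fstar (X w) + zeta w.
Hypothesis hmean : 'E_P[zeta]%E = 0%E.
Hypothesis hindep : independent_RVs zeta X.
Hypothesis hL2 : (zeta : T -> R) \in Lfun P 2%:E.
Hypothesis hsigma : 'E_P[(fun w => zeta w ^+ 2)%R]%E = (sigma ^+ 2)%:E.
Hypothesis mfstar : measurable_fun setT fstar.
Hypothesis hZ : independent_copies X Y Z.

Definition noise_process (t : 'rV[R]_M) (s : S) : R :=
  \sum_(i < N) ((Z i s).2 - fstar (Z i s).1) * lincomb F t (Z i s).1.

Lemma noise_process_lin a u t s :
  noise_process (a *: u + t) s = a * noise_process u s + noise_process t s.
Proof.
rewrite /noise_process mulr_sumr -big_split; apply: eq_bigr => i _ /=.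
by rewrite lincombP; ring.
Qed.

(** Linearity, for the functional that sends a row t to its empirical correlation
    with the noise. *)
Lemma noise_process_residual (B : 'rV[R]_M -> 'rV[R]_M -> R) es t s :
  noise_process (residual B es t) s =
  noise_process t s - \sum_(e <- es) B t e * noise_process e s.
Proof.
have np0 : noise_process 0 s = 0.
  by have := noise_process_lin 1 0 0 s; rewrite scale1r addr0 mul1r; lra.
rewrite /residual addrC -scaleN1r noise_process_lin mulN1r addrC; congr (_ - _).
by elim/big_rec2: _ => // e y v _ <-; rewrite noise_process_lin.
Qed.

Let XY w : U * R := (X w, Y w).
Let mXY : measurable_fun setT XY.
Proof. by apply: measurable_fun_pair; exact: measurable_funPT. Qed.
Let mZ i : measurable_fun setT (Z i).
Proof. exact: measurable_funPT. Qed.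
Let phi t (z : U * R) := (z.2 - fstar z.1) * lincomb F t z.1.
Let mphi t : measurable_fun setT (phi t).
Proof.
apply: measurable_funM; last exact: (measurableT_comp (measurable_lincomb F t)).
by apply: measurable_funB => //; exact: (measurableT_comp mfstar).
Qed.
Let phiXY t : phi t \o XY = fun w => zeta w * lincomb F t (X w).
Proof. by apply/funext => w; rewrite /phi /= hY addrAC subrr add0r. Qed.
Let phi2 t : phi t \o XY \in Lfun P 2%:E.
Proof.
rewrite phiXY; apply: noise_Lfun2 => //; first exact: measurable_lincomb.
exact: lincomb_Lfun2.
Qed.

Lemma noise_process_Lfun2 t : noise_process t \in Lfun Q 2%:E.
Proof.
apply: (@Lfun2_sum _ _ _ Q _ _ (fun i s => phi t (Z i s))) => i.
exact: (iid_Lfun2 mZ mXY hZ.2 (mphi t) (phi2 t)).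
Qed.

Lemma noise_process_sqr t :
  \int[Q]_s (noise_process t s ^+ 2) = N%:R * (sigma ^+ 2 * l2form X F t t).
Proof.
have phiE w : phi t (XY w) = zeta w * lincomb F t (X w).
  exact: (congr1 (@^~ w) (phiXY t)).
have mean0 : \int[P]_w phi t (XY w) = 0.
  under eq_Rintegral do rewrite phiE.
  apply: noise_mean => //; first exact: measurable_lincomb.
  exact: lincomb_Lfun2.
have := iid_mean_square mZ mXY hZ.2 (mutually_independent_pair hZ.1) (mphi t) (phi2 t) mean0.
rewrite l2form_sqr => ->; congr (_ * _).
under eq_Rintegral do rewrite phiE.
apply: noise_variance => //; first exact: measurable_lincomb.
exact: lincomb_Lfun2.
Qed.

Lemma noise_energy_tail (es : seq 'rV[R]_M) (x : R) : (size es <= M)%N ->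
  orthonormal_seq (l2form X F) es -> 0 < x ->
  (Q [set s | (x * (N%:R * (sigma ^+ 2 * M%:R)) < \sum_(e <- es) noise_process e s ^+ 2)%R]
    <= (1 / x)%:E)%E.
Proof.
move=> szM /andP[_ /allP one] x0.
have isq e := Lfun2_integrable_sqr (noise_process_Lfun2 e).
apply: Rintegral_tail => //.
- apply: measurable_sum => e; apply: measurable_funX.
  exact: Lfun2_measurable (noise_process_Lfun2 e).
- exact: integrable_sumR.
- by move=> s; apply: sumr_ge0 => e _; exact: sqr_ge0.
rewrite Rintegral_sum//.
rewrite (eq_big_seq (fun=> N%:R * sigma ^+ 2)) => [|e ees]; last first.
  by rewrite noise_process_sqr (eqP (one _ ees)) mulr1.
rewrite big_const_seq count_predT iter_addr_0 -[leLHS]mulr_natr mulrA.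
by rewrite ler_wpM2l ?ler_nat// mulr_ge0 ?sqr_ge0.
Qed.

End noise_process.

(** * From the two events to the risk bound *)

Lemma erm_basic_inequality (R : realType) (U : Type) (N : nat) (z : 'I_N -> U * R)
    (V : set (U -> R)) (fstar fhat : U -> R) : (0 < N)%N -> V fstar ->
  argmin V (empirical_risk z) fhat ->
  \sum_(i < N) (fhat (z i).1 - fstar (z i).1) ^+ 2 <=
  2 * \sum_(i < N) ((z i).2 - fstar (z i).1) * (fhat (z i).1 - fstar (z i).1).
Proof.
move=> N0 Vf [_ /(_ _ Vf)]; rewrite /empirical_risk ler_pM2l ?invr_gt0 ?ltr0n//.
rewrite -subr_ge0 -[in X in _ -> X]subr_ge0 mulr_sumr -!sumrB => h.
apply: le_trans h _; rewrite le_eqVlt; apply/orP; left; apply/eqP.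
by apply: eq_bigr => i _; ring.
Qed.

(** Apply 2 a L <= (D / 2) a^2 + (2 / D) L^2 termwise and absorb the first sum into
    D q. *)
Lemma quadratic_absorption (R : realType) (I : Type) (r : seq I) (a L : I -> R) (D q : R) :
  0 < D -> \sum_(e <- r) a e ^+ 2 <= q -> D * q <= 2 * \sum_(e <- r) a e * L e ->
  q <= 4 / D ^+ 2 * \sum_(e <- r) L e ^+ 2.
Proof.
move=> D0 aq Dq.
have am : 2 * \sum_(e <- r) a e * L e <=
    D / 2 * (\sum_(e <- r) a e ^+ 2) + 2 / D * \sum_(e <- r) L e ^+ 2.
  rewrite !mulr_sumr -big_split /=; apply: ler_sum => e _.
  rewrite -subr_ge0 (_ : _ - _ = 2^-1 * D^-1 * (D * a e - 2 * L e) ^+ 2); last first.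
    by field; rewrite gt_eqF.
  by rewrite mulr_ge0 ?sqr_ge0// mulr_ge0 ?invr_ge0 ?ler0n// ltW.
have h : D / 2 * q <= 2 / D * \sum_(e <- r) L e ^+ 2.
  have D2 : 0 <= D / 2 by rewrite divr_ge0// ltW.
  have := ler_wpM2l D2 aq; lra.
have D2V : 0 < 2 / D by rewrite divr_gt0.
have := ler_wpM2l (ltW D2V) h.
rewrite (_ : 2 / D * (D / 2 * q) = q); last by field; rewrite gt_eqF.
by rewrite mulrA (_ : 2 / D * (2 / D) = 4 / D ^+ 2)//; field; rewrite gt_eqF.
Qed.

Lemma row_functional0 (R : realType) (M : nat) (G : 'rV[R]_M -> R) :
  (forall a s t, G (a *: s + t) = a * G s + G t) ->
  (forall j, G (delta_mx 0 j) = 0) -> forall t, G t = 0.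
Proof.
move=> Glin Gd t; rewrite [t]row_sum_delta.
elim/big_rec: _ => [|j y _ IH]; last by rewrite Glin Gd mulr0 add0r.
by have := Glin 1 0 0; rewrite scale1r addr0 mul1r; lra.
Qed.

Theorem corollary1p2 (R : realType)
    (dU dT dS : measure_display)
    (U : measurableType dU) (T : measurableType dT) (S : measurableType dS)
    (mu : probability U R) (P : probability T R) (Q : probability S R)
    (X : {RV P >-> U}) (Y zeta : {RV P >-> R})
    (M N : nat) (F : 'I_M -> {mfun U >-> R}) (fstar : U -> R)
    (Z : 'I_N -> {RV Q >-> (U * R)%type})
    (sigma kappa0 beta0 : R)
    (hX : forall A : set U, measurable A -> P (X @^-1` A) = mu A)
    (hF : forall j, ('E_P[(fun w => F j (X w) ^+ 2)%R] < +oo)%E)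
    (hY : forall w, Y w = fstar (X w) + zeta w)
    (hmean : 'E_P[zeta]%E = 0%E)
    (hindep : independent_RVs zeta X)
    (hL2 : (zeta : T -> R) \in Lfun P 2%:E)
    (hsigma : 'E_P[(fun w => zeta w ^+ 2)%R]%E = (sigma ^+ 2)%:E)
    (hfstar : dict_span F fstar)
    (hkappa0 : 0 < kappa0) (hbeta0 : 0 < beta0)
    (hsmallball : forall f, dict_span F f ->
      (beta0%:E <=
       P [set w | kappa0%:E * L2norm X f <= `|f (X w)|%:E])%E)
    (hN : 400 ^+ 2 * M%:R / beta0 ^+ 2 <= N%:R)
    (hZ : independent_copies X Y Z)
    (fhat : S -> U -> R)
    (hfhat : forall s, argmin (dict_span F)
                         (empirical_risk (fun i => Z i s)) (fhat s)) :
  forall x : R, 0 < x ->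
    with_probability_at_least Q
      (1 - expR (- (beta0 ^+ 2 * N%:R / 4)) - 1 / x)
      [set s | (L2norm X (fun u => fhat s u - fstar u)%R ^+ 2 <=
                ((16 / (beta0 * kappa0 ^+ 2)) ^+ 2
                 * (sigma ^+ 2 * M%:R * x / N%:R))%:E)%E].
Proof.
move=> x x0.
have mF j : measurable_fun setT (F j : U -> R) by exact: measurable_funPT.
have mX : measurable_fun setT X by exact: measurable_funPT.
have F2 j : F j \o X \in Lfun P 2%:E.
  have mFX : measurable_fun setT (F j \o X) by exact: measurableT_comp.
  apply: Lfun2_of_sqr => //; apply/integrableP; split.
    by apply/measurable_EFinP; exact: measurable_funX.
  move: (hF j); rewrite unlock; apply: le_lt_trans.
  rewrite le_eqVlt; apply/orP; left; apply/eqP; apply: eq_integral => w _ /=.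
  by rewrite ger0_norm ?sqr_ge0.
have [tstar fstarE] := (dict_spanP F fstar).1 hfstar.
have mfstar : measurable_fun setT fstar by rewrite fstarE; exact: measurable_lincomb.
have errE s : exists t, (fun u => fhat s u - fstar u) = lincomb F t.
  have [/dict_spanP[t ->] _] := hfhat s.
  exists (t - tstar); rewrite fstarE; apply/funext => u.
  rewrite (_ : t - tstar = -1 *: tstar + t); last by rewrite scaleN1r addrC.
  by rewrite lincombP mulN1r addrC.
have normE t : (L2norm X (lincomb F t) * L2norm X (lincomb F t))%E = (l2form X F t t)%:E.
  by rewrite L2norm_lincomb// -EFinM -expr2 sqr_sqrtr// l2form_ge0.
(* For an empty dictionary N may vanish, but then so does the error. *)
have [M0|M0] := posnP M.
  exists setT; split => //.
    move=> s _ /=; have [t ->] := errE s.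
    rewrite normE l2form_coord// big1 => [|j _]; last by have := ltn_ord j; rewrite {2}M0.
    by rewrite lee_fin mulr_ge0 ?sqr_ge0// divr_ge0// mulr_ge0 ?(ltW x0)// mulr_ge0 ?sqr_ge0.
  rewrite probability_setT lee_fin.
  have := expR_ge0 (- (beta0 ^+ 2 * N%:R / 4)).
  have : 0 <= 1 / x by rewrite divr_ge0// ltW.
  lra.
have N0 : (0 < N)%N.
  rewrite -(ltr0n R); apply: lt_le_trans hN.
  by rewrite divr_gt0 ?mulr_gt0 ?exprn_gt0 ?ltr0n.
pose Xs i s := (Z i s).1.
have mXs i : measurable_fun setT (Xs i).
  by apply: (measurableT_comp measurable_fst); exact: measurable_funPT.
have mfst (A : set U) : measurable A -> measurable (A `*` [set: R]).
  by move=> mA; exact: measurableX.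
have preE i (A : set U) : Xs i @^-1` A = Z i @^-1` (A `*` [set: R]).
  by apply/seteqP; split => s //= [].
have lawXs i A : measurable A -> Q (Xs i @^-1` A) = P (X @^-1` A).
  move=> mA; rewrite preE hZ.2; last exact: mfst.
  by congr (P _); apply/seteqP; split => w //= [].
have indXs (A : 'I_N -> set U) : (forall i, measurable (A i)) ->
    Q [set s | forall i, A i (Xs i s)] = (\prod_(i < N) Q (Xs i @^-1` A i))%E.
  move=> mA; under eq_bigr do rewrite preE.
  rewrite -(mutually_independent_all hZ.1 (A := fun i => A i `*` setT)); last first.
    by move=> i; exact: mfst.
  by congr (Q _); apply/seteqP; split => s /= h i; have := h i => //= -[].
have pairXs i j : i != j -> forall A B, measurable A -> measurable B ->
    Q (Xs i @^-1` A `&` Xs j @^-1` B) = (Q (Xs i @^-1` A) * Q (Xs j @^-1` B))%E.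
  move=> ij A B mA mB; rewrite !preE.
  by apply: (mutually_independent_pair hZ.1 ij); exact: mfst.
have [B [mB QB hB]] := small_ball_sample F2 hkappa0 hbeta0 M0 hsmallball hN
  mXs lawXs indXs pairXs.
have [es [szes oes hes]] := gram_schmidt (l2formC X F) (l2form_ge0 X F)
  (l2form_lin F2) [seq delta_mx 0 j | j <- enum 'I_M].
have {}szes : (size es <= M)%N by rewrite size_map size_enum_ord in szes.
pose L := noise_process F fstar Z.
have L2 t : L t \in Lfun Q 2%:E.
  exact: (noise_process_Lfun2 F2 hY hindep hL2 mfstar hZ).
pose W s := \sum_(e <- es) L e s ^+ 2.
have mL2 t : measurable_fun setT (fun s => L t s ^+ 2).
  exact/measurable_funX/Lfun2_measurable/L2.
have mW : measurable_fun setT W by apply: measurable_sum => e; exact: mL2.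
pose r j : 'rV[R]_M := residual (l2form X F) es (delta_mx 0 j).
pose lev := x * (N%:R * (sigma ^+ 2 * M%:R)).
pose BW := [set s | lev < W s].
pose V s := \sum_(j < M) L (r j) s ^+ 2.
have mV : measurable_fun setT V by apply: measurable_sum => j; exact: mL2.
pose BV := [set s | 0 < V s].
have mBW : measurable BW by exact: measurable_set_lt.
have mBV : measurable BV by exact: measurable_set_lt.
have QBW : (Q BW <= (1 / x)%:E)%E.
  exact: (noise_energy_tail F2 hY hmean hindep hL2 hsigma mfstar hZ).
have isq t : Q.-integrable setT (EFin \o (fun s => L t s ^+ 2)).
  exact: Lfun2_integrable_sqr.
have V0 s : 0 <= V s by apply: sumr_ge0 => j _; exact: sqr_ge0.
have QBV : Q BV = 0%E.
  apply: Rintegral0_null => //; first exact: integrable_sumR.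
  rewrite Rintegral_sum// big1// => j _.
  rewrite (noise_process_sqr F2 hY hmean hindep hL2 hsigma mfstar hZ) hes ?mulr0//.
  by apply: map_f; rewrite mem_enum.
exists (~` (B `|` BW `|` BV)); split.
- by apply: measurableC; do 2 apply: measurableU => //.
- move=> s /= /not_orP[/not_orP[nB nBW] nBV].
  have [t tE] := errE s; rewrite tE normE lee_fin.
  set q := l2form X F t t.
  have q0 : 0 <= q by exact: l2form_ge0.
  have Ws : W s <= lev by rewrite leNgt; exact/negP.
  have Lr j : L (r j) s = 0.
    have Vs : V s = 0 by apply/eqP; rewrite eq_le V0 andbT leNgt; exact/negP.
    apply/eqP; rewrite -sqrf_eq0; apply/eqP.
    by apply: (psumr_eq0P _ Vs) => // k _; exact: sqr_ge0.
  (* Both sides are linear in t and agree on the basis because L vanishes on the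
     residuals of the basis vectors. *)
  have Lexp : L t s = \sum_(e <- es) l2form X F t e * L e s.
    pose G t := L t s - \sum_(e <- es) l2form X F t e * L e s.
    apply/eqP; rewrite -subr_eq0; apply/eqP.
    apply: (row_functional0 (G := G)) => [a u v|j].
      rewrite /G /L noise_process_lin.
      under eq_bigr do rewrite l2form_lin// mulrDl -mulrA.
      by rewrite big_split /= -mulr_sumr; ring.
    by rewrite -(Lr j) /L noise_process_residual.
  have basic : \sum_(i < N) lincomb F t (Xs i s) ^+ 2 <= 2 * L t s.
    have := erm_basic_inequality N0 hfstar (hfhat s).
    have tu u : fhat s u - fstar u = lincomb F t u := congr1 (@^~ u) tE.
    by under eq_bigr do rewrite tu; under [X in _ <= _ * X]eq_bigr do rewrite tu.
  pose D := kappa0 ^+ 2 * (beta0 * N%:R / 8).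
  have D0 : 0 < D by rewrite mulr_gt0 ?exprn_gt0// divr_gt0// mulr_gt0// ltr0n.
  have lower : D * q <= \sum_(i < N) lincomb F t (Xs i s) ^+ 2.
    have := ler_wpM2l (mulr_ge0 (sqr_ge0 kappa0) q0) (hB s nB t).
    rewrite (_ : _ * _ * (_ / _) = D * q); last by rewrite /D; ring.
    move=> /le_trans; apply; rewrite mulr_sumr; apply: ler_sum => i _.
    have [h|_] := boolP (kappa0 * Num.sqrt q <= `|lincomb F t (Xs i s)|)%R; last first.
      by rewrite mulr0 sqr_ge0.
    rewrite mulr1 -(sqr_sqrtr q0) -exprMn -[leRHS](real_normK (num_real _)).
    by apply: lerXn2r; rewrite ?nnegrE// mulr_ge0// ltW.
  have Dq : D * q <= 2 * \sum_(e <- es) l2form X F t e * L e s.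
    by rewrite -Lexp; exact: le_trans lower basic.
  have bes : \sum_(e <- es) l2form X F t e ^+ 2 <= q.
    exact: (bessel (l2formC X F) (l2form_ge0 X F) (l2form_lin F2)).
  apply: (le_trans (quadratic_absorption D0 bes Dq)).
  have D2 : 0 <= 4 / D ^+ 2 by rewrite divr_ge0// sqr_ge0.
  apply: (le_trans (ler_wpM2l D2 Ws)).
  rewrite le_eqVlt; apply/orP; left; apply/eqP; rewrite /lev /D.
  by field; rewrite !gt_eqF ?ltr0n.
rewrite probability_setC; last by do 2 apply: measurableU => //.
have mBW' : measurable (B `|` BW) by exact: measurableU.
have QU : (Q (B `|` BW `|` BV) <= (expR (- (beta0 ^+ 2 * N%:R / 4)) + 1 / x)%:E)%E.
  have U1 : (Q (B `|` BW `|` BV) <= Q (B `|` BW) + Q BV)%E by exact: measureU2.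
  have U2 : (Q (B `|` BW) <= Q B + Q BW)%E by exact: measureU2.
  by apply: (le_trans U1); rewrite QBV adde0 EFinD; apply: (le_trans U2); exact: leeD.
move: QU; rewrite -[X in (X <= _)%E]fineK ?fin_num_measure//; last exact: measurableU.
rewrite -[X in (_ <= _ - X)%E]fineK ?fin_num_measure//; last exact: measurableU.
by rewrite -EFinB !lee_fin; lra.
Qed.
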